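(* Let $\mathcal{B}\subseteq\mathcal{M}$ be a unital inclusion of type $\mathrm{III}$ factors. Then $$W^*(\mathcal{N}_{\mathcal{M}}(\mathcal{B}))=W^*(\mathcal{GN}_{\mathcal{M}}(\mathcal{B}))=W^*(\mathcal{UN}_{\mathcal{M}}(\mathcal{B})).$$ Consequently, $\mathcal{B}$ is regular in $\mathcal{M}$ if and only if it is unitary regular in $\mathcal{M}$.
   Context: For a unital inclusion of von Neumann algebras $\mathcal{B}\subseteq\mathcal{M}$ (i.e. $1_{\mathcal{B}}=1_{\mathcal{M}}$), put $\mathcal{N}_{\mathcal{M}}(\mathcal{B})=\{n\in\mathcal{M}: n\mathcal{B}n^*\cup n^*\mathcal{B}n\subseteq\mathcal{B}\}$ (normaliser), $\mathcal{GN}_{\mathcal{M}}(\mathcal{B})=\{v\in\mathcal{N}_{\mathcal{M}}(\mathcal{B}): vv^*v=v\}$ (groupoid normaliser), and $\mathcal{UN}_{\mathcal{M}}(\mathcal{B})=\{u\in\mathcal{M}\text{ unitary}: u\mathcal{B}u^*=\mathcal{B}\}$ (unitary normaliser). $W^*(S)$ denotes the von Neumann subalgebra of $\mathcal{M}$ generated by $S$. $\mathcal{B}$ is regular in $\mathcal{M}$ if $W^*(\mathcal{N}_{\mathcal{M}}(\mathcal{B}))=\mathcal{M}$ and unitary regular in $\mathcal{M}$ if $W^*(\mathcal{UN}_{\mathcal{M}}(\mathcal{B}))=\mathcal{M}$. *)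

(* Defs.v *)
From HB Require Import structures.
From mathcomp Require Import all_boot all_order all_algebra.
From mathcomp Require Import sesquilinear complex.
From mathcomp Require Import all_classical all_reals all_analysis.

Set Implicit Arguments.
Unset Strict Implicit.
Unset Printing Implicit Defensive.

Import Order.TTheory GRing.Theory Num.Theory.
Import numFieldNormedType.Exports.

Local Open Scope classical_set_scope.
Local Open Scope ring_scope.

(* The inner product is linear in its first argument and conjugate-linear in
   its second one. *)
HB.mixin Record isHilbert (R : realType) H of CompleteNormedModule R[i] H := {
  inner : {dot H for (Num.conj : R[i] -> R[i])};
  sqr_norm_inner : forall x : H, `|x| ^+ 2 = inner x x
}.

#[short(type="hilbertType")]
HB.structure Definition Hilbert (R : realType) :=
  {H of isHilbert R H & CompleteNormedModule R[i] H}.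

Section VonNeumannAlgebras.
Context {R : realType} {H : hilbertType R}.

Implicit Types (S T p q u v n : H -> H) (B M : set (H -> H)).

Definition bounded_operators : set (H -> H) :=
  [set T | linear T /\ continuous T].

(* For a bounded [T], exactly one [S] satisfies the defining identity (Riesz),
   and it is bounded; the default value [0] is used for unbounded [T] only. *)
Definition adjoint T : H -> H :=
  xget 0 [set S | forall x y : H, inner (T x) y = inner x (S y)].

Definition commutant M : set (H -> H) :=
  [set T | bounded_operators T /\ forall S, M S -> T \o S = S \o T].

(* A von Neumann algebra acting on [H] is a self-adjoint set of bounded
   operators equal to its bicommutant. It is then a *-subalgebra containing the
   identity, so an inclusion of two of them is automatically unital. *)
Definition von_neumann_algebra M : Prop :=
  [/\ M `<=` bounded_operators,
      forall T, M T -> M (adjoint T)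
    & commutant (commutant M) = M].

Definition vN_factor M : Prop :=
  von_neumann_algebra M /\
  M `&` commutant M = range (fun (c : R[i]) (x : H) => c *: x).

Definition projections M : set (H -> H) :=
  [set p | [/\ M p, p \o p = p & adjoint p = p]].

(* Murray-von Neumann equivalence relative to [M]. *)
Definition mvn_equiv M p q : Prop :=
  exists v, [/\ M v, adjoint v \o v = p & v \o adjoint v = q].

Definition subprojection q p : Prop := p \o q = q.

Definition finite_projection M p : Prop :=
  projections M p /\
  forall q, projections M q -> subprojection q p -> mvn_equiv M p q -> q = p.

Definition type_III M : Prop := forall p, finite_projection M p -> p = 0.

Definition type_III_factor M : Prop := vN_factor M /\ type_III M.

Definition normaliser M B : set (H -> H) :=
  [set n | M n /\ forall b, B b ->
    B (n \o b \o adjoint n) /\ B (adjoint n \o b \o n)].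

Definition groupoid_normaliser M B : set (H -> H) :=
  [set v | normaliser M B v /\ v \o adjoint v \o v = v].

Definition unitary_normaliser M B : set (H -> H) :=
  [set u | [/\ M u, adjoint u \o u = id, u \o adjoint u = id
             & [set u \o b \o adjoint u | b in B] = B]].

Definition Wstar M (A : set (H -> H)) : set (H -> H) :=
  smallest [set N | von_neumann_algebra N /\ N `<=` M] A.

Definition regular M B : Prop := Wstar M (normaliser M B) = M.

Definition unitary_regular M B : Prop := Wstar M (unitary_normaliser M B) = M.

End VonNeumannAlgebras.

(* Main.v *)
From HB Require Import structures.
From mathcomp Require Import all_boot all_order all_algebra.
From mathcomp Require Import sesquilinear complex.
From mathcomp Require Import all_classical all_reals all_analysis.
From mathcomp Require Import ring lra.
Require Import Defs.

Set Implicit Arguments.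
Unset Strict Implicit.
Unset Printing Implicit Defensive.

Import Order.TTheory GRing.Theory Num.Theory.
Import numFieldNormedType.Exports.

Local Open Scope classical_set_scope.
Local Open Scope ring_scope.

(** Unitary normalisers are groupoid normalisers, and groupoid normalisers are
    normalisers.  Hence the three generated algebras agree as soon as every von
    Neumann algebra [N] that contains the unitary normalisers of [B] contains
    all its normalisers.  This is reached in three steps.

    First, [N] contains [B] ([B_generated]).  For a self-adjoint [a] of [B], the
    unitary part [v] of [1 + i a] is a unitary of [B], hence lies in [N], and
    [a] can be recovered from [v] inside every algebra containing [v].

    Second, a normaliser [n] has a polar decomposition [n = v (v^! n)] in which
    [v^! n] lies in [B] and the partial isometry [v] normalises [B] again: both
    are strong limits of expressions [n h] and [h n^! n] with [h] in [B]
    ([polar], [normaliser_generated]).  So only partial isometries matter.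

    Third, let [v] be a partial isometry normalising [B].  By exhaustion it
    suffices to find, below each nonzero projection [f <= v^! v] of [B], a
    nonzero projection [p] of [B] with [v p] in [N]
    ([exists_generated_subprojection], [groupoid_generated]).  The Hilbert space
    may be nonseparable, so two nonzero projections of [B] need not be
    equivalent; but two nonzero projections that have separating vectors are
    ([separating_equivalent]).  Take for [p] the projection onto the closure of
    [B' xi], with [xi] in the range of [f]: then [xi] separates [p], and [v xi]
    separates [q = v p v^!].  A partial isometry [w] of [B] from [q] to [p]
    turns [v p] into [s = w v p], which normalises [B] and satisfies
    [s^! s = s s^! = p].  By Zorn's lemma [s] extends to a unitary normaliser
    [u] ([unitary_extension]), because a maximal extension that misses a nonzero
    projection [r] of [B] could be enlarged by a copy [e s e^!] of [s], where
    [e] in [B] embeds [p] in [r].  Then [v p = w^! u p] lies in [N].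

    The equivalence of separated projections rests on a domination result: a
    projection [q] with a separating vector embeds in every nonzero projection
    [p] of [B] ([separating_dominated]).  As [p] is infinite, it contains a
    sequence of orthogonal equivalent copies of some [e <> 0]; one sends
    successive pieces of [q] into successive copies, each time taking a piece
    that is nearly as large as possible when measured at the separating vector,
    and what remains of [q] in the end must vanish.  A Schroeder-Bernstein
    argument finishes. *)

(** * Real inner product and convergence *)

Section InnerProduct.
Context {R : realType} {H : hilbertType R}.
Implicit Types (x y z : H) (a : R[i]) (r : R).

Lemma inner_conj x y : inner x y = conjc (inner y x).
Proof. by rewrite hermC /= expr0 mul1r. Qed.

Lemma innerZr a x y : inner x (a *: y) = conjc a * inner x y.
Proof. exact: linearZr_LR. Qed.

Lemma innerDl x y z : inner (x + y) z = inner x z + inner y z.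
Proof. exact: linearDl. Qed.

Lemma innerBl x y z : inner (x - y) z = inner x z - inner y z.
Proof. exact: linearBl. Qed.

Lemma innerZl a x y : inner (a *: x) y = a * inner x y.
Proof. exact: linearZl_LR. Qed.

Lemma inner0l x : inner 0 x = 0. Proof. exact: linear0l. Qed.

Lemma innerDr x y z : inner x (y + z) = inner x y + inner x z.
Proof. exact: linearDr. Qed.

Let Re_real_mul r a : complex.Re (r%:C%C * a) = r * complex.Re a.
Proof. by case: a => b c /=; rewrite mul0r subr0. Qed.

Let Re_conji_mul a : complex.Re (conjc 'i%C * a) = complex.Im a.
Proof. by case: a => b c /=; ring. Qed.

(** The norm of [H] takes its values in [R[i]], whose order is partial.  All
    estimates are made with the real part of the inner product and with the
    squared norm, which live in the ordered field [R]. *)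
Definition rinner x y : R := complex.Re (inner x y).

Definition sqnorm x : R := rinner x x.

Lemma rinnerC x y : rinner x y = rinner y x.
Proof. by rewrite /rinner inner_conj; case: (inner y x). Qed.

Lemma rinnerDl x y z : rinner (x + y) z = rinner x z + rinner y z.
Proof. by rewrite /rinner linearDl raddfD. Qed.

Lemma rinnerDr x y z : rinner z (x + y) = rinner z x + rinner z y.
Proof. by rewrite ![rinner z _]rinnerC rinnerDl. Qed.

Lemma rinnerZl r x y : rinner (r%:C%C *: x) y = r * rinner x y.
Proof. by rewrite /rinner linearZl_LR Re_real_mul. Qed.

Lemma rinnerZr r x y : rinner x (r%:C%C *: y) = r * rinner x y.
Proof. by rewrite rinnerC rinnerZl rinnerC. Qed.

Lemma rinnerNl x y : rinner (- x) y = - rinner x y.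
Proof. by rewrite /rinner linearNl raddfN. Qed.

Lemma rinnerNr x y : rinner x (- y) = - rinner x y.
Proof. by rewrite rinnerC rinnerNl rinnerC. Qed.

Lemma rinnerBl x y z : rinner (x - y) z = rinner x z - rinner y z.
Proof. by rewrite rinnerDl rinnerNl. Qed.

Lemma rinnerBr x y z : rinner z (x - y) = rinner z x - rinner z y.
Proof. by rewrite rinnerDr rinnerNr. Qed.

Lemma rinner0l x : rinner 0 x = 0.
Proof. by rewrite /rinner linear0l. Qed.

Lemma rinner0r x : rinner x 0 = 0.
Proof. by rewrite rinnerC rinner0l. Qed.

(** The real inner product determines the complex one, since multiplying the
    second argument by [i] exchanges real and imaginary parts. *)
Lemma Im_inner x y : complex.Im (inner x y) = rinner x ('i%C *: y).
Proof. by rewrite /rinner innerZr Re_conji_mul. Qed.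

Lemma inner_eq0 x y : rinner x y = 0 -> rinner x ('i%C *: y) = 0 ->
  inner x y = 0.
Proof.
by rewrite -Im_inner /rinner; case: (inner x y) => a b /= -> ->.
Qed.

Lemma norm_sqnorm x : `|x| ^+ 2 = (sqnorm x)%:C%C.
Proof.
rewrite sqr_norm_inner /sqnorm /rinner.
have : inner x x \is Num.real by rewrite -sqr_norm_inner rpredX// normr_real.
by move=> /RRe_real.
Qed.

Lemma sqnorm_ge0 x : 0 <= sqnorm x.
Proof. by rewrite -lecR -norm_sqnorm exprn_ge0. Qed.

Lemma sqnorm_eq0 x : sqnorm x = 0 -> x = 0.
Proof.
move=> x0; have /eqP : `|x| ^+ 2 = 0 by rewrite norm_sqnorm x0.
by rewrite expf_eq0 /= => /eqP /normr0_eq0.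
Qed.

Lemma sqnorm0 : sqnorm (0 : H) = 0. Proof. exact: rinner0l. Qed.

Lemma sqnormN x : sqnorm (- x) = sqnorm x.
Proof. by rewrite /sqnorm rinnerNl rinnerNr opprK. Qed.

Lemma sqnormB x y : sqnorm (x - y) = sqnorm (y - x).
Proof. by rewrite -sqnormN opprB. Qed.

Lemma sqnormZ r x : sqnorm (r%:C%C *: x) = r ^+ 2 * sqnorm x.
Proof. by rewrite /sqnorm rinnerZl rinnerZr mulrA expr2. Qed.

Lemma sqnormDE x y : sqnorm (x + y) = sqnorm x + 2 * rinner x y + sqnorm y.
Proof. by rewrite /sqnorm rinnerDl !rinnerDr (rinnerC y x); ring. Qed.

Lemma sqnormBE x y : sqnorm (x - y) = sqnorm x - 2 * rinner x y + sqnorm y.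
Proof. by rewrite sqnormDE rinnerNr sqnormN; ring. Qed.

Lemma parallelogram x y :
  sqnorm (x + y) + sqnorm (x - y) = 2 * sqnorm x + 2 * sqnorm y.
Proof. by rewrite sqnormDE sqnormBE; ring. Qed.

Lemma sqnormD_le x y : sqnorm (x + y) <= 2 * sqnorm x + 2 * sqnorm y.
Proof. by rewrite -parallelogram lerDl sqnorm_ge0. Qed.

Lemma rinner_ext x y : (forall z, rinner x z = rinner y z) -> x = y.
Proof.
move=> h; apply/subr0_eq/sqnorm_eq0.
by rewrite /sqnorm rinnerBl h subrr.
Qed.

Lemma cauchy_schwarz x y : rinner x y ^+ 2 <= sqnorm x * sqnorm y.
Proof.
have [/sqnorm_eq0 ->|y0] := eqVneq (sqnorm y) 0.
  by rewrite rinner0r sqnorm0 expr0n mulr0.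
(* the vector is sqnorm y times the component of x orthogonal to y *)
have := sqnorm_ge0 ((sqnorm y)%:C%C *: x - (rinner x y)%:C%C *: y).
rewrite sqnormBE !sqnormZ rinnerZl rinnerZr.
set a := sqnorm x; set b := sqnorm y; set c := rinner x y => h.
have b0 : 0 < b by rewrite lt0r y0 sqnorm_ge0.
by rewrite -(ler_pM2l b0) mulrC; nra.
Qed.

Lemma norm_lt_sqnorm x r : 0 < r -> (`|x| < r%:C%C) = (sqnorm x < r ^+ 2).
Proof.
move=> r0; rewrite -ltcR -norm_sqnorm rmorphXn /= ltr_pXn2r // nnegrE ?normr_ge0 //.
by rewrite ler0c ltW.
Qed.

Section Convergence.
Context {I : Type} (F : set_system I).

Lemma cvg_sqnormP {FF : Filter F} (f : I -> H) l :
  f @ F --> l <->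
  forall e : R, 0 < e -> \forall i \near F, sqnorm (f i - l) < e.
Proof.
split=> [/cvgrPdist_lt fl e e0 | fl].
  have se0 : 0 < Num.sqrt e by rewrite sqrtr_gt0.
  have := fl (Num.sqrt e)%:C%C; rewrite ltcR => /(_ se0).
  apply: filterS => i; rewrite norm_lt_sqnorm // sqr_sqrtr ?ltW //.
  by rewrite sqnormB.
apply/cvgrPdist_lt => e e0.
have er : e = (complex.Re e)%:C%C by rewrite RRe_real // gtr0_real.
have r0 : 0 < complex.Re e by rewrite -ltcR -er.
rewrite er; have /fl : 0 < complex.Re e ^+ 2 by rewrite exprn_gt0.
by apply: filterS => i; rewrite norm_lt_sqnorm // sqnormB.
Qed.

Lemma cauchy_cvg_sqnorm {FF : ProperFilter F} (f : I -> H) :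
  (forall e : R, 0 < e ->
     exists i, \forall j \near F, sqnorm (f j - f i) < e) ->
  cvg (f @ F).
Proof.
move=> fc; apply/cauchy_cvgP/cauchyP => e e0.
have er : e = (complex.Re e)%:C%C by rewrite RRe_real // gtr0_real.
have r0 : 0 < complex.Re e by rewrite -ltcR -er.
have /fc[i fi] : 0 < complex.Re e ^+ 2 by rewrite exprn_gt0.
exists (f i); rewrite er -ball_normE /nbhs /=.
by apply: filterS fi => j fij; rewrite /ball_ /= norm_lt_sqnorm // sqnormB.
Qed.

Lemma cvg_sub0 {FF : Filter F} (f : I -> H) l :
  f @ F --> l <-> (fun i => f i - l) @ F --> (0 : H).
Proof.
by rewrite !cvg_sqnormP; split=> h e /h; apply: filterS => i; rewrite subr0.
Qed.

Lemma cvgr0_rinner {FF : Filter F} (f g : I -> H) (c : R) :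
  f @ F --> (0 : H) -> (\forall i \near F, sqnorm (g i) <= c) ->
  (fun i => rinner (f i) (g i)) @ F --> (0 : R).
Proof.
move=> /cvg_sqnormP f0 gc; apply/cvgrPdist_lt => e e0.
have c0 : 0 < `|c| + 1 by rewrite ltr_wpDl.
have /f0 : 0 < e ^+ 2 / (`|c| + 1) by rewrite divr_gt0 ?exprn_gt0.
move=> fe; near=> i.
rewrite sub0r normrN -(@ltr_pXn2r _ 2) ?nnegrE ?normr_ge0 ?(ltW e0) //.
rewrite real_normK ?num_real //.
apply: le_lt_trans (cauchy_schwarz _ _) _.
have gi : sqnorm (g i) <= c by near: i.
have fi : sqnorm (f i - 0) < e ^+ 2 / (`|c| + 1) by near: i; exact: fe.
rewrite subr0 ltr_pdivlMr // in fi; apply: le_lt_trans fi.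
rewrite ler_wpM2l ?sqnorm_ge0 // (le_trans gi) // (le_trans (ler_norm _)) //.
by rewrite lerDl.
Unshelve. all: by end_near. Qed.

Lemma cvg_rinner {FF : Filter F} (f g : I -> H) l m :
  f @ F --> l -> g @ F --> m ->
  (fun i => rinner (f i) (g i)) @ F --> rinner l m.
Proof.
move=> fl gm; rewrite -[rinner l m]addr0 -[rinner l m]addr0.
have fl0 := (@cvg_sub0 FF _ _).1 fl; have gm0 := (@cvg_sub0 FF _ _).1 gm.
have -> : (fun i => rinner (f i) (g i)) = (fun i => rinner l m +
    rinner (f i - l) m + (rinner (f i - l) (g i - m) + rinner (g i - m) l)).
  apply/funext => i; rewrite !rinnerBl !rinnerBr !(rinnerC l).
  by rewrite -(rinnerC l (g i)); ring.
apply: cvgD; [apply: cvgD; first exact: cvg_cst|rewrite -[0]addr0; apply: cvgD].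
- by apply: (cvgr0_rinner (c := sqnorm m)) => //; exact: nearW.
- apply: (cvgr0_rinner (c := 1)) => //; have := (@cvg_sqnormP FF _ _).1 gm0 _ ltr01.
  by apply: filterS => i; rewrite subr0 => /ltW.
- by apply: (cvgr0_rinner (c := sqnorm l)) => //; exact: nearW.
Qed.

Lemma cvg_sqnorm {FF : Filter F} (f : I -> H) l :
  f @ F --> l -> (fun i => sqnorm (f i)) @ F --> sqnorm l.
Proof. by move=> fl; exact: cvg_rinner. Qed.

Lemma cvg_rinnerl {FF : Filter F} (f : I -> H) l y :
  f @ F --> l -> (fun i => rinner (f i) y) @ F --> rinner l y.
Proof. by move=> fl; apply: cvg_rinner => //; exact: cvg_cst. Qed.

Lemma cvg_uniq {FF : ProperFilter F} (f : I -> H) (l m : H) :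
  f @ F --> l -> f @ F --> m -> l = m.
Proof. by apply: cvg_unique; exact: norm_hausdorff. Qed.

Lemma cvg_uniqR {FF : ProperFilter F} (f : I -> R) (l m : R) :
  f @ F --> l -> f @ F --> m -> l = m.
Proof. by apply: cvg_unique; exact: norm_hausdorff. Qed.

Lemma rinner_lim_cst {FF : ProperFilter F} (f : I -> H) (l y : H) (c : R) :
  f @ F --> l -> (forall i, rinner (f i) y = c) -> rinner l y = c.
Proof.
move=> fl fc; have fyl : (fun i => rinner (f i) y) @ F --> rinner l y.
  exact: cvg_rinnerl.
apply: cvg_uniqR fyl _; by under eq_fun do rewrite fc; exact: cvg_cst.
Qed.

Lemma sqnorm_lim_le {FF : ProperFilter F} (f : I -> H) (l : H) (c : R) :
  f @ F --> l -> (forall i, sqnorm (f i) <= c) -> sqnorm l <= c.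
Proof.
move=> /cvg_sqnorm fl fc; rewrite -(cvg_lim _ fl); last exact: norm_hausdorff.
by apply: limr_le; [apply/cvg_ex; exists (sqnorm l)|exact: nearW].
Qed.

Lemma sqnorm_lim_ge {FF : ProperFilter F} (f : I -> H) (l : H) (c : R) :
  f @ F --> l -> (forall i, c <= sqnorm (f i)) -> c <= sqnorm l.
Proof.
move=> /cvg_sqnorm fl fc; rewrite -(cvg_lim _ fl); last exact: norm_hausdorff.
by apply: limr_ge; [apply/cvg_ex; exists (sqnorm l)|exact: nearW].
Qed.

End Convergence.
End InnerProduct.

(** * Orthogonal projection and adjoints *)

Section BoundedOperators.
Context {R : realType} {H : hilbertType R}.
Implicit Types (x y z : H) (T : H -> H).

Lemma bounded_operatorsP T :
  bounded_operators T <->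
  linear T /\ exists2 c : R, 0 <= c & forall x, sqnorm (T x) <= c * sqnorm x.
Proof.
split=> -[linT].
  pose f : {linear H -> H} :=
    HB.pack T (GRing.isLinear.Build R[i] H H *:%R T linT).
  move=> contT; have : bounded_near f (nbhs 0).
    by apply/linear_bounded_continuous.
  move=> /linear_boundedP /pinfty_ex_gt0[r r0 fr]; split => //.
  have er : r = (complex.Re r)%:C%C by rewrite RRe_real // gtr0_real.
  exists (complex.Re r ^+ 2) => [|x]; first exact: sqr_ge0.
  rewrite -lecR rmorphM rmorphXn /= -er -!norm_sqnorm -exprMn.
  by rewrite lerXn2r // nnegrE ?mulr_ge0 // ltW.
move=> [c c0 Tc]; split => // x; apply/cvg_sqnormP => e e0.
have c1 : 0 < c + 1 by rewrite ltr_wpDl.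
have : id y @[y --> x] --> x by exact: cvg_id.
move=> /cvg_sqnormP/(_ (e / (c + 1))); rewrite divr_gt0 // => /(_ isT).
apply: filterS => y yx.
have -> : T y - T x = T (y - x) by rewrite addrC -scaleN1r -linT scaleN1r addrC.
apply: le_lt_trans (Tc _) _; rewrite ltr_pdivlMr // in yx.
apply: le_lt_trans yx; rewrite mulrC ler_wpM2l ?sqnorm_ge0 //.
by rewrite lerDl.
Qed.

Lemma quadratic_ge0_eq0 (a b : R) : (forall t, 0 <= t * b + t ^+ 2 * a) -> b = 0.
Proof.
move=> h; apply/eqP; rewrite -sqrf_eq0; apply/eqP.
have [a0|a0] := leP a 0.
  have := h (-b); have := h b; have := sqr_ge0 b; nra.
(* the minimum of the parabola *)
have := h (- b / (2 * a)).
have -> : - b / (2 * a) * b + (- b / (2 * a)) ^+ 2 * a = - (b ^+ 2 / (4 * a)).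
  by field; rewrite gt_eqF.
rewrite oppr_ge0 pmulr_lle0 ?invr_gt0 ?mulr_gt0 // => b0.
by apply/eqP; rewrite eq_le b0 sqr_ge0.
Qed.

Definition seq_closed (K : set H) :=
  forall (u : nat -> H) l, (forall n, K (u n)) -> u n @[n --> \oo] --> l -> K l.

(** A minimising sequence for the distance from [x] to [K] is Cauchy by the
    parallelogram law, and at a point of minimal distance the first variation
    vanishes in all directions of [K]. *)
Lemma projection_theorem (K : set H) x : K 0 ->
    (forall a y z, K y -> K z -> K (a *: y + z)) -> seq_closed K ->
  exists2 y, K y & forall z, K z -> inner (x - y) z = 0.
Proof.
move=> K0 Klin Kcl.
have KZ a z : K z -> K (a *: z).
  by move=> Kz; rewrite -[_ *: _]addr0; exact: Klin.
pose D := [set sqnorm (x - z) | z in K].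
have Dinf : has_inf D.
  split; first by exists (sqnorm (x - 0)); exists 0.
  by exists 0 => _ [z _ <-]; exact: sqnorm_ge0.
have Dle z : K z -> inf D <= sqnorm (x - z).
  by move=> Kz; apply: ge_inf; [exact: Dinf.2|exists z].
have /choice[u uP] n : exists z, K z /\ sqnorm (x - z) < inf D + n.+1%:R^-1.
  have n0 : 0 < n.+1%:R^-1 :> R by rewrite invr_gt0.
  have [_ [z Kz <-] zn] := inf_adherent n0 Dinf.
  by exists z.
have ucauchy n m : sqnorm (u n - u m) <= 2 * (n.+1%:R^-1 + m.+1%:R^-1).
  have [Kn un] := uP n; have [Km um] := uP m.
  have := parallelogram (x - u m) (x - u n).
  have -> : x - u m - (x - u n) = u n - u m by rewrite opprB addrC addrA subrK.
  (* the midpoint lies in K, hence is at distance at least inf D *)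
  pose w := 2^-1%:C%C *: (u n + u m).
  have Kw : K w.
    by rewrite /w scalerDr; apply: (Klin) => //; exact: KZ.
  have -> : x - u m + (x - u n) = 2%:C%C *: (x - w).
    rewrite scalerBr /w scalerA -rmorphM /= divff // scale1r.
    by rewrite rmorphD /= scalerDl scale1r opprD addrACA [- u m - _]addrC.
  have := Dle _ Kw; rewrite sqnormZ; move: (sqnorm (x - w)) => d dI h.
  move: un um h; move: n.+1%:R^-1 m.+1%:R^-1 (sqnorm _) (sqnorm _) (sqnorm _).
  by move=> a b p q r; lra.
have ucvg : cvg (u n @[n --> \oo]).
  apply: cauchy_cvg_sqnorm => e e0.
  have e4 : 0 < e / 4 by rewrite divr_gt0.
  have [n nP] : exists n, n.+1%:R^-1 < e / 4.
    have [n _ nP] := near_infty_natSinv_lt (PosNum e4).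
    by exists n; exact: nP n (leqnn n).
  exists n; near=> m; apply: le_lt_trans (ucauchy m n) _.
  have mn : m.+1%:R^-1 < e / 4.
    by near: m; exact: near_infty_natSinv_lt (PosNum e4).
  by move: mn nP; move: n.+1%:R^-1 m.+1%:R^-1 => a b; lra.
have Ky : K (lim (u n @[n --> \oo])) by apply: Kcl ucvg => n; exact: (uP n).1.
set y := lim _ in Ky ucvg.
have xyD : sqnorm (x - y) <= inf D.
  have lim1 : (fun n => sqnorm (x - u n)) @ \oo --> sqnorm (x - y).
    by apply: cvg_sqnorm; apply: cvgB => //; exact: cvg_cst.
  have lim2 : (fun n => inf D + n.+1%:R^-1) @ \oo --> inf D.
    rewrite -[X in _ --> X]addr0; apply: cvgD; first exact: cvg_cst.
    exact: cvg_harmonic.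
  by apply: ler_cvg_to lim1 lim2 _; apply: nearW => n; exact: ltW (uP n).2.
exists y => // z Kz.
have orth z' : K z' -> rinner (x - y) z' = 0.
  move=> Kz'; apply/eqP; rewrite -(mulrI_eq0 _ (@mulfI _ (-2) _)) //; apply/eqP.
  apply: (@quadratic_ge0_eq0 (sqnorm z')) => t.
  have : inf D <= sqnorm (x - (t%:C%C *: z' + y)) by apply/Dle/Klin.
  rewrite opprD addrA addrAC [in leRHS]sqnormBE sqnormZ rinnerZr.
  by move: xyD; lra.
by apply: inner_eq0; apply: orth => //; exact: KZ.
Unshelve. all: by end_near. Qed.

(** Unless [f] vanishes, its kernel has a nonzero orthogonal vector, and a
    multiple of that vector represents [f]. *)
Lemma riesz_representation (f : H -> R[i]) :
    (forall a x y, f (a *: x + y) = a * f x + f y) ->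
    seq_closed [set x | f x = 0] ->
  exists w, forall x, f x = inner x w.
Proof.
move=> flin fcl.
have f0 : f 0 = 0.
  by have := flin (-1) 0 0; rewrite scaler0 addr0 mulN1r addNr.
have fZ a x : f (a *: x) = a * f x by rewrite -[a *: x]addr0 flin f0 addr0.
have fB x y : f (x - y) = f x - f y.
  by rewrite addrC -scaleN1r flin mulN1r addrC.
have [[z fz]|fz] := pselect (exists z, f z <> 0); last first.
  exists 0 => x; rewrite linear0r; apply/eqP/negPn/negP => /eqP fx.
  by apply: fz; exists x.
have [||y fy yorth] := @projection_theorem [set x | f x = 0] z f0.
- by move=> a x y /= fx fy; rewrite flin fx fy mulr0 addr0.
- exact: fcl.
set v := z - y in yorth.
have fv : f v = f z by rewrite /v fB fy subr0.
have vv0 : inner v v != 0.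
  apply/eqP => vv; apply: fz; rewrite -fv.
  by have -> : v = 0; [apply: sqnorm_eq0; rewrite /sqnorm /rinner vv|].
exists ((conjc (f v) / inner v v) *: v) => x.
have : inner v (f v *: x - f x *: v) = 0.
  by apply: yorth; rewrite /= fB !fZ mulrC subrr.
move=> /(congr1 conjc); rewrite -inner_conj conjc0 linearBl linearZl_LR /=.
rewrite linearZl_LR /= innerZr => /subr0_eq fvx.
rewrite rmorphM /= conjcK conjc_inv -inner_conj.
by rewrite mulrAC fvx mulfK.
Qed.

Lemma linearB_of T x y : linear T -> T (x - y) = T x - T y.
Proof. by move=> linT; rewrite addrC -scaleN1r linT scaleN1r addrC. Qed.

Lemma cvg_bounded_operator T {I} (F : set_system I) {FF : Filter F}
    (f : I -> H) l :
  bounded_operators T -> f @ F --> l -> (fun i => T (f i)) @ F --> T l.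
Proof. by move=> [_ /(_ l)]; exact: continuous_cvg. Qed.

Lemma adjointP T : bounded_operators T ->
  forall x y, inner (T x) y = inner x (adjoint T y).
Proof.
move=> bT; rewrite /adjoint.
apply: (@xgetPex _ 0 [set S | forall x y, inner (T x) y = inner x (S y)]).
suff /choice[S TS] y : exists w, forall x, inner (T x) y = inner x w.
  by exists S => x y.
apply: riesz_representation => [a x z|u l /= uK ul].
  by rewrite bT.1 linearDl linearZl_LR.
have Tul : (fun n => T (u n)) @ \oo --> T l by exact: cvg_bounded_operator.
by apply: inner_eq0; apply: rinner_lim_cst Tul _ => n;
  rewrite -?Im_inner /rinner uK.
Qed.

Lemma inner_ext x y : (forall z, inner z x = inner z y) -> x = y.
Proof. by move=> xy; apply: rinner_ext => z; rewrite !(rinnerC _ z) /rinner xy. Qed.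

Lemma adjoint_uniq T S :
  (forall x y, inner (T x) y = inner x (S y)) -> adjoint T = S.
Proof.
move=> TS; have := @xgetPex _ 0 [set S | forall x y, inner (T x) y = inner x (S y)].
move=> /(_ (ex_intro _ S TS)) TS'; apply/funext => y; apply: inner_ext => z.
by rewrite -TS' TS.
Qed.

(** With [z = adjoint T y], the Cauchy-Schwarz inequality for
    [sqnorm z = <T z, y>] shows that the adjoint obeys the same bound as [T]. *)
Lemma bounded_adjoint T : bounded_operators T -> bounded_operators (adjoint T).
Proof.
move=> bT; have TA := adjointP bT.
have /bounded_operatorsP[_ [c c0 Tc]] := bT.
apply/bounded_operatorsP; split=> [a x y|].
  apply: inner_ext => z.
  by rewrite -TA !innerDr !innerZr !TA.
exists c => // y; set z := adjoint T y.
have zE : sqnorm z = rinner (T z) y by rewrite /sqnorm /rinner TA.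
have := cauchy_schwarz (T z) y; rewrite -zE => h.
have [->|z0] := eqVneq (sqnorm z) 0; first by rewrite mulr_ge0 ?sqnorm_ge0.
have zp : 0 < sqnorm z by rewrite lt0r z0 sqnorm_ge0.
rewrite -(ler_pM2l zp) -expr2; apply: le_trans h _.
by rewrite mulrCA mulrA ler_wpM2r ?sqnorm_ge0.
Qed.

End BoundedOperators.

(** * The ring of bounded operators *)

(** Bounded operators are bundled to form a ring under composition.  Through the
    coercion to functions, membership of a bundled operator in a set of
    functions needs no conversion. *)
Record op (R : realType) (H : hilbertType R) :=
  Op { op_fun :> H -> H; op_bounded : bounded_operators op_fun }.

Section OperatorAlgebra.
Context {R : realType} {H : hilbertType R}.
Implicit Types (S T : op H) (x y : H) (a : R[i]) (r : R).

Lemma opP S T : (forall x, S x = T x) -> S = T.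
Proof.
case: S T => [S bS] [T bT] /= /funext ST; case: _ / ST in bT *.
by congr Op; exact: Prop_irrelevance.
Qed.

HB.instance Definition _ := gen_eqMixin (op H).
HB.instance Definition _ := gen_choiceMixin (op H).

Lemma op_linear T a x y : T (a *: x + y) = a *: T x + T y.
Proof. exact: (op_bounded T).1. Qed.

Lemma op0 T : T 0 = 0.
Proof. by have := linearB_of 0 0 (op_bounded T).1; rewrite subr0 subrr. Qed.

Lemma opD T x y : T (x + y) = T x + T y.
Proof. by rewrite -[x in LHS]scale1r op_linear scale1r. Qed.

Lemma opB T x y : T (x - y) = T x - T y.
Proof. exact: linearB_of (op_bounded T).1. Qed.

Lemma opN T x : T (- x) = - T x.
Proof. by rewrite -sub0r opB op0 sub0r. Qed.

Lemma opZ T a x : T (a *: x) = a *: T x.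
Proof. by rewrite -[a *: x]addr0 op_linear op0 addr0. Qed.

Lemma op_bound T : exists2 c : R, 0 <= c & forall x, sqnorm (T x) <= c * sqnorm x.
Proof. by have /bounded_operatorsP[] := op_bounded T. Qed.

Let bounded_comp S T : bounded_operators (S \o T).
Proof.
apply/bounded_operatorsP; split=> [a x y|] /=; first by rewrite !op_linear.
have [c c0 Sc] := op_bound S; have [d d0 Td] := op_bound T.
exists (c * d) => [|x]; first exact: mulr_ge0.
by rewrite -mulrA; apply: le_trans (Sc _) _; rewrite ler_wpM2l.
Qed.

Let bounded_add S T : bounded_operators (fun x => S x + T x).
Proof.
apply/bounded_operatorsP; split=> [a x y|] /=.
  by rewrite !op_linear scalerDr addrACA.
have [c c0 Sc] := op_bound S; have [d d0 Td] := op_bound T.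
exists (2 * c + 2 * d) => [|x]; first by rewrite addr_ge0 ?mulr_ge0.
apply: le_trans (sqnormD_le _ _) _; rewrite [leRHS]mulrDl -!mulrA.
by apply: lerD; rewrite ler_wpM2l.
Qed.

Lemma bounded_scalar a : bounded_operators (fun x : H => a *: x).
Proof.
apply/bounded_operatorsP; split=> [b x y|].
  by rewrite scalerDr !scalerA mulrC.
exists (complex.Re (`|a| ^+ 2)) => [|x].
  by rewrite sqr_normc; case: a => b c /=; rewrite mulrN opprK -!expr2 addr_ge0 ?sqr_ge0.
have er : `|a| ^+ 2 = (complex.Re (`|a| ^+ 2))%:C%C.
  by rewrite RRe_real // rpredX // normr_real.
by rewrite -lecR rmorphM /= -er -!norm_sqnorm normrZ exprMn.
Qed.

Let bounded_opp T : bounded_operators (fun x => - T x).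
Proof.
apply/bounded_operatorsP; split=> [a x y|]; first by rewrite op_linear opprD scalerN.
by have [c c0 Tc] := op_bound T; exists c => // x; rewrite sqnormN.
Qed.

Let bounded_zero : bounded_operators (fun=> 0 : H).
Proof.
apply/bounded_operatorsP; split=> [a x y|]; first by rewrite scaler0 addr0.
by exists 0 => // x; rewrite sqnorm0 mul0r.
Qed.

Let bounded_id : bounded_operators (@id H).
Proof. by apply/bounded_operatorsP; split=> //; exists 1 => // x; rewrite mul1r. Qed.

Let bounded_scale a T : bounded_operators (fun x => a *: T x) :=
  bounded_comp (Op (bounded_scalar a)) T.

Definition zeroop := Op bounded_zero.
Definition oneop := Op bounded_id.
Definition addop S T := Op (bounded_add S T).
Definition oppop T := Op (bounded_opp T).
Definition mulop S T := Op (bounded_comp S T).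
Definition scaleop a T := Op (bounded_scale a T).

(* the ring may be trivial, as H may be zero; hence a pzRingType *)
Let addopA : associative addop.
Proof. by move=> S T U; apply: opP => x /=; rewrite addrA. Qed.
Let addopC : commutative addop.
Proof. by move=> S T; apply: opP => x /=; rewrite addrC. Qed.
Let add0op : left_id zeroop addop.
Proof. by move=> S; apply: opP => x /=; rewrite add0r. Qed.
Let addNop : left_inverse zeroop oppop addop.
Proof. by move=> S; apply: opP => x /=; rewrite addNr. Qed.
HB.instance Definition _ :=
  GRing.isZmodule.Build (op H) addopA addopC add0op addNop.

Let mulopA : associative mulop.
Proof. by move=> S T U; apply: opP. Qed.
Let mul1op : left_id oneop mulop.
Proof. by move=> S; apply: opP. Qed.
Let mulop1 : right_id oneop mulop.
Proof. by move=> S; apply: opP. Qed.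
Let mulopDl : left_distributive mulop addop.
Proof. by move=> S T U; apply: opP. Qed.
Let mulopDr : right_distributive mulop addop.
Proof. by move=> S T U; apply: opP => x /=; rewrite opD. Qed.
HB.instance Definition _ :=
  GRing.Zmodule_isPzRing.Build (op H) mulopA mul1op mulop1 mulopDl mulopDr.

Let scaleopA a b T : scaleop a (scaleop b T) = scaleop (a * b) T.
Proof. by apply: opP => x /=; rewrite scalerA. Qed.
Let scale1op : left_id 1 scaleop.
Proof. by move=> T; apply: opP => x /=; rewrite scale1r. Qed.
Let scaleopDr : right_distributive scaleop +%R.
Proof. by move=> a S T; apply: opP => x /=; rewrite scalerDr. Qed.
Let scaleopDl T : {morph scaleop^~ T : a b / a + b}.
Proof. by move=> a b; apply: opP => x /=; rewrite scalerDl. Qed.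
HB.instance Definition _ :=
  GRing.Zmodule_isLmodule.Build R[i] (op H) scaleopA scale1op scaleopDr scaleopDl.

Lemma addopE S T x : (S + T) x = S x + T x. Proof. by []. Qed.
Lemma mulopE S T x : (S * T) x = S (T x). Proof. by []. Qed.
Lemma scaleopE a T x : (a *: T) x = a *: T x. Proof. by []. Qed.
Lemma zeropE x : (0 : op H) x = 0. Proof. by []. Qed.
Lemma oneopE x : (1 : op H) x = x. Proof. by []. Qed.
Lemma oppopE T x : (- T) x = - T x. Proof. by []. Qed.
Lemma subopE S T x : (S - T) x = S x - T x. Proof. by []. Qed.
Definition opE := (addopE, oppopE, scaleopE, zeropE, oneopE, mulopE).

Lemma scaleopAl a S T : (a *: S) * T = a *: (S * T).
Proof. by apply: opP. Qed.

Lemma scaleopAr a S T : S * (a *: T) = a *: (S * T).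
Proof. by apply: opP => x; rewrite !opE opZ. Qed.

Definition star T : op H := Op (bounded_adjoint (op_bounded T)).
Local Notation "T ^!" := (star T).

Lemma inner_star T x y : inner (T x) y = inner x (T^! y).
Proof. exact: adjointP (op_bounded T) x y. Qed.

Lemma star_uniq S T : (forall x y, inner (T x) y = inner x (S y)) -> T^! = S.
Proof. by move=> TS; apply: opP => x /=; rewrite (adjoint_uniq TS). Qed.

Lemma starK T : T^!^! = T.
Proof.
by apply: star_uniq => x y; rewrite inner_conj -inner_star -inner_conj.
Qed.

Lemma rinner_star T x y : rinner (T x) y = rinner x (T^! y).
Proof. by rewrite /rinner inner_star. Qed.

Lemma rinner_starV T x y : rinner x (T y) = rinner (T^! x) y.
Proof. by rewrite rinner_star starK. Qed.

Lemma starM S T : (S * T)^! = T^! * S^!.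
Proof. by apply: star_uniq => x y; rewrite mulopE !inner_star. Qed.

Lemma starD S T : (S + T)^! = S^! + T^!.
Proof. by apply: star_uniq => x y; rewrite addopE innerDl addopE innerDr !inner_star. Qed.

Lemma star1 : (1 : op H)^! = 1.
Proof. by apply: star_uniq => x y; rewrite !oneopE. Qed.

Lemma starZ a T : (a *: T)^! = conjc a *: T^!.
Proof.
by apply: star_uniq => x y; rewrite !scaleopE innerZl innerZr conjcK inner_star.
Qed.

Lemma starN T : (- T)^! = - T^!.
Proof. by rewrite -scaleN1r starZ rmorphN1 scaleN1r. Qed.

Lemma starB S T : (S - T)^! = S^! - T^!.
Proof. by rewrite starD starN. Qed.

Lemma star0 : (0 : op H)^! = 0.
Proof. by rewrite -[in LHS](subrr 1) starB subrr. Qed.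

Lemma starZr r T : (r%:C%C *: T)^! = r%:C%C *: T^!.
Proof. by rewrite starZ conjc_real. Qed.

Lemma star_mul_eq0 T : T^! * T = 0 -> T = 0.
Proof.
move=> TT; apply: opP => x; rewrite zeropE; apply: sqnorm_eq0.
by rewrite /sqnorm rinner_star -mulopE TT zeropE rinner0r.
Qed.

Definition proj (p : op H) := p * p = p /\ p^! = p.

Lemma proj_sqnorm (p : op H) x : proj p -> sqnorm (p x) = rinner (p x) x.
Proof. by move=> [pp ps]; rewrite /sqnorm rinner_starV ps -mulopE pp. Qed.

Lemma proj1B (p : op H) : proj p -> proj (1 - p).
Proof.
move=> [pp ps]; split; last by rewrite starB star1 ps.
by rewrite mulrBl mul1r mulrBr mulr1 pp subrr subr0.
Qed.

(** * Closed linear spans *)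

Section ClosedSpan.
Variable S : set H.

Let orth := [set x | forall s, S s -> inner x s = 0].

Let orth0 : orth 0. Proof. by move=> s _; rewrite inner0l. Qed.

Let orth_lin a x y : orth x -> orth y -> orth (a *: x + y).
Proof.
move=> ox oy s Ss.
by rewrite innerDl innerZl ox // oy // addr0 mulr0.
Qed.

Let orth_closed : seq_closed orth.
Proof.
move=> u l uK ul s Ss.
by apply: inner_eq0; apply: rinner_lim_cst ul _ => n;
  rewrite -?Im_inner /rinner uK.
Qed.

Let decomposition : exists P : H -> H, forall x,
  orth (P x) /\ forall z, orth z -> inner (x - P x) z = 0.
Proof.
suff /choice[P PP] x : exists y : H, orth y /\
  forall z, orth z -> inner (x - y) z = 0 by exists P.
have [y oy yP] := projection_theorem x orth0 orth_lin orth_closed.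
by exists y.
Qed.

Let P := projT1 (cid decomposition).
Let PP x : orth (P x) /\ forall z, orth z -> inner (x - P x) z = 0.
Proof. by rewrite /P; case: cid. Qed.

Let inner_P x z : orth z -> inner x z = inner (P x) z.
Proof. by move=> oz; apply/subr0_eq; rewrite -innerBl (PP x).2. Qed.

Let P_uniq x y : orth y -> (forall z, orth z -> inner x z = inner y z) ->
  y = P x.
Proof.
move=> oy yP; apply/subr0_eq.
have od : orth (y - P x).
  by rewrite addrC -scaleN1r; apply: orth_lin => //; exact: (PP x).1.
by apply: sqnorm_eq0; rewrite /sqnorm /rinner innerBl -yP // -inner_P // subrr.
Qed.

Let bounded_P : bounded_operators P.
Proof.
apply/bounded_operatorsP; split=> [a x y|].
  apply/esym/P_uniq; first by apply: orth_lin; exact: (PP _).1.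
  by move=> z oz; rewrite !innerDl !innerZl -!inner_P.
exists 1 => // x; rewrite mul1r.
have h : rinner (x - P x) (P x) = 0.
  by rewrite /rinner (PP x).2 //; exact: (PP x).1.
have -> : sqnorm x = sqnorm (x - P x) + sqnorm (P x).
  by rewrite -[in LHS](subrK (P x) x) (sqnormDE (x - P x)) h mulr0 addr0.
by rewrite lerDr sqnorm_ge0.
Qed.

(** The projection onto the closed linear span of [S], which is the orthogonal
    complement of the closed subspace [orth].  Projections with
    a prescribed range are obtained in this way below; their membership in an
    algebra is then read off from [S]. *)
Definition closed_span : op H := 1 - Op bounded_P.

Lemma closed_span_id s : S s -> closed_span s = s.
Proof.
move=> Ss; rewrite /closed_span subopE oneopE /=.
rewrite (_ : P s = 0) ?subr0 //; apply/esym/P_uniq; first exact: orth0.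
by move=> z oz; rewrite inner0l inner_conj oz // conjc0.
Qed.

Lemma closed_span_orth x : (forall s, S s -> inner x s = 0) -> closed_span x = 0.
Proof.
move=> ox; rewrite /closed_span subopE oneopE /=.
by rewrite -(@P_uniq x x) // subrr.
Qed.

Let star_P : (Op bounded_P)^! = Op bounded_P.
Proof.
apply: star_uniq => x y /=.
rewrite (inner_P x (PP y).1) inner_conj [in RHS]inner_conj; congr conjc.
exact: inner_P (PP x).1.
Qed.

Lemma closed_span_proj : proj closed_span.
Proof.
apply: proj1B; split; last exact: star_P.
by apply: opP => x /=; apply/esym/P_uniq => //; exact: (PP x).1.
Qed.

(** If [S] is stable under [T] and [T^!], then so is its orthogonal complement,
    and an operator that leaves a subspace and its complement invariant commutes
    with the projection. *)
Lemma closed_span_comm T : (forall s, S s -> S (T s)) ->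
  (forall s, S s -> S (T^! s)) -> T * closed_span = closed_span * T.
Proof.
move=> ST STs; rewrite /closed_span mulrBr mulrBl mul1r mulr1; congr (_ - _).
apply: opP => x; apply: P_uniq => [s Ss|z oz] /=.
  by rewrite inner_star; apply: (PP x).1; exact: STs.
by rewrite !inner_star; apply: inner_P => s Ss; rewrite inner_star starK oz //; exact: ST.
Qed.

Lemma closed_span_mul T : (forall s, S s -> T s = 0) -> T * closed_span = 0.
Proof.
move=> TS; suff: closed_span * T^! = 0.
  move=> /(congr1 star); rewrite starM starK star0.
  by rewrite closed_span_proj.2.
apply: opP => x; rewrite mulopE zeropE; apply: closed_span_orth => s Ss.
by rewrite inner_star starK TS // inner_conj inner0l conjc0.
Qed.

End ClosedSpan.
End OperatorAlgebra.

(** * Strong limits *)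

Notation "T ^!" := (star T) : ring_scope.

(** Paired with arbitrary vectors, an identity of noncommutative polynomials in
    operators becomes a linear identity between the real numbers obtained from
    the monomials, which the commutative tactics decide. *)
Ltac op_ring := apply: opP => ?; apply: rinner_ext => ?;
  rewrite !(opE, opD, opB, opN, opZ, rinnerDl, rinnerNl, rinnerZl,
    rinner0l);
  by [ring | field].

Section StrongLimits.
Context {R : realType} {H : hilbertType R}.
Implicit Types (S T L : op H) (x y : H).

Definition contraction T := forall x, sqnorm (T x) <= sqnorm x.

Definition strong_cvg {I} (F : set_system I) (T : I -> op H) (L : op H) :=
  forall x, (fun i => T i x) @ F --> L x.

Section Filter.
Context {I : Type} {F : set_system I} {FF : ProperFilter F}.
Implicit Types (A B : I -> op H).

Lemma strong_cvg_mull T A L : strong_cvg F A L ->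
  strong_cvg F (fun i => T * A i) (T * L).
Proof.
by move=> AL x; apply: cvg_bounded_operator (AL x); exact: op_bounded.
Qed.

Lemma strong_cvg_mulr T A L : strong_cvg F A L ->
  strong_cvg F (fun i => A i * T) (L * T).
Proof. by move=> AL x; exact: AL. Qed.

Lemma strong_cvg_mul A B L S : (forall i, contraction (A i)) ->
  strong_cvg F A L -> strong_cvg F B S ->
  strong_cvg F (fun i => A i * B i) (L * S).
Proof.
move=> cA AL BS x; apply/cvg_sqnormP => e e0.
have e4 : 0 < e / 4 by rewrite divr_gt0.
have /cvg_sqnormP/(_ _ e4) := AL (S x); have /cvg_sqnormP/(_ _ e4) := BS x.
apply: filterS2 => i BSi ALi; rewrite !mulopE.
have -> : A i (B i x) - L (S x) = A i (B i x - S x) + (A i (S x) - L (S x)).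
  by rewrite opB addrA subrK.
apply: le_lt_trans (sqnormD_le _ _) _.
by have := cA i (B i x - S x); move: BSi ALi; lra.
Qed.

Lemma strong_cvg_uniq A L S : strong_cvg F A L -> strong_cvg F A S -> L = S.
Proof.
by move=> AL AS; apply: opP => x; apply: cvg_uniq (AL x) (AS x).
Qed.

Lemma strong_cvg_star A L S : strong_cvg F A L ->
  strong_cvg F (fun i => (A i)^!) S -> S = L^!.
Proof.
move=> AL AS; apply: opP => y; apply: rinner_ext => x.
rewrite [in RHS]rinnerC -rinner_star.
have Ly : (fun i => rinner (A i x) y) @ F --> rinner (L x) y.
  exact: cvg_rinnerl (AL x).
have Sy : (fun i => rinner (A i x) y) @ F --> rinner (S y) x.
  under eq_fun do rewrite rinner_star rinnerC.
  exact: cvg_rinnerl (AS y).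
by rewrite (cvg_uniqR Ly Sy).
Qed.

Lemma strong_limit A : (forall i, contraction (A i)) ->
    (forall x, cvg ((fun i => A i x) @ F)) ->
  exists2 L : op H, contraction L & strong_cvg F A L.
Proof.
move=> cA Acvg; pose L x : H := lim ((fun i => A i x) @ F).
have AL x : (fun i => A i x) @ F --> L x by exact: Acvg.
have cL x : sqnorm (L x) <= sqnorm x by apply: sqnorm_lim_le (AL x) _ => i; exact: cA.
have bL : bounded_operators L.
  apply/bounded_operatorsP; split; last by exists 1 => // x; rewrite mul1r.
  move=> a x y; apply: cvg_uniq (AL _) _; under eq_fun do rewrite op_linear.
  apply: cvgD => //; apply: cvg_bounded_operator (AL x).
  exact: bounded_scalar.
by exists (Op bL).
Qed.

(** The numbers [sqnorm (A i x)] increase and are bounded, hence converge, and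
    the hypothesis on differences then makes [A i x] Cauchy.  Increasing chains
    of partial isometries and the Newton iteration both satisfy it. *)
Lemma strong_limit_monotone (le : I -> I -> Prop) A :
    (forall i, \forall j \near F, le i j) ->
    (forall i, contraction (A i)) ->
    (forall i j x, le i j ->
       sqnorm (A j x - A i x) <= sqnorm (A j x) - sqnorm (A i x)) ->
  exists2 L : op H, contraction L & strong_cvg F A L.
Proof.
move=> leF cA Ale; apply: strong_limit => // x; apply: cauchy_cvg_sqnorm => e e0.
pose D := range (fun i => sqnorm (A i x)).
have supD : has_sup D.
  have [i _] := filter_ex (filterT : F setT).
  split; first by exists (sqnorm (A i x)); exists i.
  by exists (sqnorm x) => _ [j _ <-]; exact: cA.
have [_ [i _ <-] ei] := sup_adherent e0 supD.
exists i; apply: filterS (leF i) => j /(Ale _ _ x) /le_lt_trans; apply.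
have : sqnorm (A j x) <= sup D by apply: ub_le_sup; [exact: supD.2|exists j].
by move: ei; lra.
Qed.

End Filter.

(** * Positive operators *)

Definition pos T := T^! = T /\ forall x, 0 <= rinner (T x) x.

Lemma pos_conj T S : pos S -> pos (T^! * S * T).
Proof.
move=> [Ss Sp]; split=> [|x]; first by rewrite !starM starK Ss mulrA.
by rewrite !mulopE rinner_star starK.
Qed.

Lemma pos1 : pos 1.
Proof. by split=> [|x]; rewrite ?star1 // oneopE sqnorm_ge0. Qed.

Lemma pos_star_mul T : pos (T^! * T).
Proof. by rewrite -[T^!]mulr1; apply: pos_conj; exact: pos1. Qed.

Lemma posD S T : pos S -> pos T -> pos (S + T).
Proof.
move=> [Ss Sp] [Ts Tp]; split=> [|x]; first by rewrite starD Ss Ts.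
by rewrite addopE rinnerDl addr_ge0.
Qed.

Lemma posZ (r : R) T : 0 <= r -> pos T -> pos (r%:C%C *: T).
Proof.
move=> r0 [Ts Tp]; split=> [|x]; first by rewrite starZr Ts.
by rewrite scaleopE rinnerZl mulr_ge0.
Qed.

Lemma archimedean_contra (a b : R) : 0 < a -> (forall n, n%:R * a <= b) -> False.
Proof.
move=> a0 h; have := h (Num.truncn (b / a)).+1.
rewrite -ler_pdivlMr // => hb.
by have := le_lt_trans hb (truncnS_gt _); rewrite ltxx.
Qed.

Let quadratic_bound (c p q t u w : R) : t < 0 -> u <= t -> u ^+ 2 <= w * p ->
  w <= c * q -> 0 <= q -> 0 <= p -> t ^+ 2 <= q * (c * p + 1).
Proof.
move=> t0 ut uw wq q0 p0.
have tu : t ^+ 2 <= u ^+ 2 by nra.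
have : w * p <= c * q * p by rewrite ler_wpM2r.
by lra.
Qed.

(** The recursion [b_0 = b], [b_{k+1} = b_k - b_k ^ 2] stays between 0 and 1, so
    [b - b_n] is the sum of the squares [b_k ^ 2] for [k < n] and [a b - a b_n]
    is the sum of the positive operators [b_k a b_k].  As the sum of the
    [sqnorm (b_k x)] is bounded, [b_k x] is small for some [k], and then so is
    [<a b_k x, x>], which is at most [<a b x, x>]. *)
Lemma pos_mul_le1 a b : pos a -> pos b -> pos (1 - b) -> a * b = b * a ->
  pos (a * b).
Proof.
move=> pa pb pb1 ab; split=> [|x]; first by rewrite starM pa.1 pb.1.
pose B n : op H := iter n (fun c : op H => c - c * c) b.
have BS n : B n.+1 = B n - B n * B n by [].
have BP n : [/\ pos (B n), pos (1 - B n) & a * B n = B n * a].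
  elim: n => [//|n [pB pB1 aB]]; rewrite BS; set c := B n in pB pB1 aB *.
  split.
  (* the two decompositions exhibit positivity without square roots *)
  - have -> : c - c * c = c^! * (1 - c) * c + (1 - c)^! * c * (1 - c).
      by rewrite starB star1 pB.1; op_ring.
    by apply: posD; apply: pos_conj.
  - have -> : 1 - (c - c * c) = (1 - c) + c^! * c by rewrite pB.1; op_ring.
    by apply: posD => //; exact: pos_star_mul.
  - by rewrite mulrBr mulrBl mulrA aB -!mulrA aB.
have aBle n : rinner ((a * B n) x) x <= rinner ((a * b) x) x.
  elim: n => [//|n]; apply: le_trans.
  have [pB _ aB] := BP n; rewrite BS.
  have -> : a * B n = a * (B n - B n * B n) + (B n)^! * a * B n.
    by rewrite pB.1 -aB; op_ring.
  by rewrite [in leRHS]addopE rinnerDl lerDl; exact: (pos_conj _ pa).2.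
have sumB n : \sum_(k < n) sqnorm (B k x) = rinner (b x) x - rinner (B n x) x.
  elim: n => [|n IHn]; first by rewrite big_ord0 subrr.
  have [[Bs _] _ _] := BP n; rewrite BS big_ord_recr /= IHn.
  by rewrite rinnerBl (rinner_star (B n) (B n x)) Bs /sqnorm; ring.
rewrite leNgt; apply/negP => neg; set t := rinner _ _ in neg aBle.
have [c c0 ac] := op_bound a.
have K0 : 0 < c * sqnorm x + 1 by rewrite ltr_wpDl // mulr_ge0 // sqnorm_ge0.
apply: (@archimedean_contra (t ^+ 2 / (c * sqnorm x + 1)) (rinner (b x) x)).
  by rewrite divr_gt0 // exprn_even_gt0 //= lt_eqF.
move=> n; apply: (@le_trans _ _ (\sum_(k < n) sqnorm (B k x))); last first.
  by rewrite sumB gerBl; have [[_ ]] := BP n.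
rewrite mulrC mulr_natr -[X in _ *+ X]card_ord -sumr_const.
apply: ler_sum => k _; rewrite ler_pdivrMr //.
have := cauchy_schwarz ((a * B k) x) x; have := aBle k.
have := ac (B k x); rewrite -mulopE; move: (rinner _ _) (sqnorm _) => u w.
have := sqnorm_ge0 x; have := sqnorm_ge0 (B k x).
move: (sqnorm _) (sqnorm _) => p q p0 q0 wp ut uw.
exact: (quadratic_bound neg ut uw wp).
Qed.

(** Scaling [b] below 1 reduces this to [pos_mul_le1]. *)
Lemma pos_mul a b : pos a -> pos b -> a * b = b * a -> pos (a * b).
Proof.
move=> pa pb ab; have [c c0 bc] := op_bound b.
have c1 : 0 < c + 1 by rewrite ltr_wpDl.
have -> : a * b = (c + 1)%:C%C *: (a * ((c + 1)^-1%:C%C *: b)).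
  rewrite scaleopAr scalerA -rmorphM /= divff ?gt_eqF //.
  by rewrite scale1r.
apply: posZ; first exact: ltW.
have pb' : pos ((c + 1)^-1%:C%C *: b) by apply: posZ; rewrite // invr_ge0 ltW.
apply: pos_mul_le1 => //; last by rewrite scaleopAr scaleopAl ab.
split=> [|x]; first by rewrite starB star1 pb'.1.
rewrite subopE oneopE scaleopE rinnerBl rinnerZl subr_ge0.
rewrite mulrC ler_pdivrMr // -/(sqnorm x).
have := sqnorm_ge0 (b x - x); have := bc x; have := sqnorm_ge0 x.
by rewrite sqnormBE; clear ab; nra.
Qed.

Lemma pos_contraction n : contraction n -> pos (1 - n^! * n).
Proof.
move=> cn; split=> [|x]; first by rewrite starB star1 (pos_star_mul n).1.
by rewrite subopE oneopE rinnerBl mulopE rinner_star starK subr_ge0; exact: cn.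
Qed.

End StrongLimits.

(** * Polar decomposition by Newton iteration *)

Section PolarDecomposition.
Context {R : realType} {H : hilbertType R}.
Implicit Types (S T : op H) (x y : H).

Section Iteration.
Variable m : op H.

(** The Newton-Schulz iteration [X_0 = n], [X_{k+1} = X_k (3 - X_k^! X_k) / 2]
    tends to the partial isometry of the polar decomposition of a contraction
    [n].  Here [m] stands for [n^! n]; the first component is the factor [g_k]
    with [X_k = n g_k], the second is the defect [c_k = (1 - X_k^! X_k) / 2].
    In terms of the defect the step reads [X_{k+1} = X_k (1 + c_k)] and
    [c_{k+1} = c_k ^ 3 + (3 / 2) c_k ^ 2], which keeps the defect positive. *)
Fixpoint newton k : op H * op H :=
  if k is k'.+1 then
    let: (g, c) := newton k' in
    (g * (1 + c), c * c * c + (3 / 2)%:C%C *: (c * c))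
  else (1, (2^-1)%:C%C *: (1 - m)).

Definition newton_factor k := (newton k).1.
Definition newton_defect k := (newton k).2.
Local Notation g := newton_factor.
Local Notation c := newton_defect.

Lemma newton_factorS k : g k.+1 = g k * (1 + c k).
Proof. by rewrite /g /c /=; case: newton. Qed.

Lemma newton_defectS k : c k.+1 = c k * c k * c k + (3 / 2)%:C%C *: (c k * c k).
Proof. by rewrite /g /c /=; case: newton. Qed.

Lemma commr_scale (a : R[i]) S T : GRing.comm S T -> GRing.comm S (a *: T).
Proof. by rewrite /GRing.comm scaleopAr scaleopAl => ->. Qed.

(** The iterates are polynomials in [m]. *)
Lemma newton_comm S : GRing.comm S m ->
  forall k, GRing.comm S (g k) /\ GRing.comm S (c k).
Proof.
move=> Sm; elim=> [|k [Sg Sc]].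
  split; first exact: commr1.
  by apply: commr_scale; apply: commrB => //; exact: commr1.
rewrite newton_factorS newton_defectS; split.
  by apply: commrM => //; apply: commrD => //; exact: commr1.
have Scc : GRing.comm S (c k * c k) by exact: commrM.
by apply: commrD; [exact: commrM|exact: commr_scale].
Qed.

Let gm k : GRing.comm m (g k). Proof. by have [] := newton_comm (erefl (m * m)) k. Qed.
Let cm k : GRing.comm m (c k). Proof. by have [] := newton_comm (erefl (m * m)) k. Qed.
Let gg j k : GRing.comm (g j) (g k).
Proof. by have [] := newton_comm (commr_sym (gm j)) k. Qed.
Let gc j k : GRing.comm (g j) (c k).
Proof. by have [] := newton_comm (commr_sym (gm j)) k. Qed.

Lemma newton_invariant k : g k * m * g k + (c k + c k) = 1.
Proof.
elim: k => [|k IH].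
  rewrite /g /c /= mul1r mulr1 -scalerDl.
  have half : (2^-1)%:C%C + (2^-1)%:C%C = 1 :> R[i].
    by rewrite -rmorphD /=; congr (_%:C%C); field.
  by rewrite half scale1r addrCA subrr addr0.
have -> : g k.+1 * m * g k.+1 = (1 + c k) * (g k * m * g k) * (1 + c k).
  have gc1 : g k * (1 + c k) = (1 + c k) * g k.
    by apply: commrD => //; exact: commr1.
  by rewrite newton_factorS {1}gc1 !mulrA.
have -> : g k * m * g k = 1 - (c k + c k) by rewrite -IH addrK.
by rewrite newton_defectS; op_ring.
Qed.

Hypothesis m_pos : pos m.
Hypothesis m_le1 : pos (1 - m).

Lemma newton_defect_pos k : pos (c k).
Proof.
elim: k => [|k ck]; first by apply: posZ; rewrite // invr_ge0.
rewrite newton_defectS; apply: posD; first by rewrite -{1}ck.1; exact: pos_conj.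
by apply: posZ; [rewrite divr_ge0|rewrite -{1}ck.1; exact: pos_star_mul].
Qed.

Lemma newton_factor_pos k : pos (g k).
Proof.
elim: k => [|k gk]; first exact: pos1.
rewrite newton_factorS; apply: pos_mul => //.
  by apply: posD; [exact: pos1|exact: newton_defect_pos].
by apply: commrD; [exact: commr1|exact: gc].
Qed.

(** For [j <= k] this is [X_j^! X_k >= X_j^! X_j], since [X_k] is [X_j] times
    commuting factors [1 + c_i >= 1]. *)
Lemma newton_monotone j k : (j <= k)%N ->
  pos (g j * m * g k - g j * m * g j).
Proof.
have gmg_pos i l : pos (g i * m * g l).
  apply: pos_mul.
  - by apply: pos_mul => //; [exact: newton_factor_pos|exact/commr_sym/gm].
  - exact: newton_factor_pos.
  - by apply/commr_sym/commrM; [exact: gg|exact/commr_sym/gm].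
elim: k => [|k IH]; first by rewrite leqn0 => /eqP ->; rewrite subrr; split=> [|x];
  rewrite ?star0 // zeropE rinner0l.
rewrite leq_eqVlt => /orP[/eqP ->|/IH jk].
  by rewrite subrr; split=> [|x]; rewrite ?star0 // zeropE rinner0l.
have -> : g j * m * g k.+1 - g j * m * g j =
    (g j * m * g k - g j * m * g j) + g j * m * g k * c k.
  by rewrite newton_factorS; op_ring.
apply: posD => //; apply: pos_mul => //; first exact: newton_defect_pos.
apply/commr_sym/commrM; last exact/commr_sym/gc.
by apply: commrM; [exact/commr_sym/gc|exact/commr_sym/cm].
Qed.

End Iteration.

Local Notation g n := (newton_factor (n^! * n)).
Local Notation c n := (newton_defect (n^! * n)).

(** The adjoints [X_k^!] form the iteration started at [n^!]; so they converge
    strongly too. *)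
Lemma newton_intertwine n k : g n k * n^! = n^! * g n^! k /\
  c n k * n^! = n^! * c n^! k.
Proof.
rewrite starK.
have itM A B A' B' : A * n^! = n^! * B -> A' * n^! = n^! * B' ->
    A * A' * n^! = n^! * (B * B').
  by move=> AB AB'; rewrite -mulrA AB' !mulrA AB.
have itD A B A' B' : A * n^! = n^! * B -> A' * n^! = n^! * B' ->
    (A + A') * n^! = n^! * (B + B').
  by move=> AB AB'; rewrite mulrDl mulrDr AB AB'.
have it1 : 1 * n^! = n^! * 1 by rewrite mul1r mulr1.
have itZ (a : R[i]) A B : A * n^! = n^! * B -> (a *: A) * n^! = n^! * (a *: B).
  by move=> AB; rewrite scaleopAl scaleopAr AB.
elim: k => [|k [gk ck]].
  split; first exact: it1.
  by apply: itZ; rewrite mulrBl mulrBr it1 mulrA.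
rewrite !newton_factorS !newton_defectS.
have ckk := itM _ _ _ _ ck ck.
split; first by apply: (itM) gk _; exact: itD.
by apply: (itD) (itM _ _ _ _ ckk ck) _; exact: itZ.
Qed.

Lemma newton_strong_cvg n : contraction n ->
  [/\ forall k, contraction (n * g n k),
      forall k x, sqnorm (n x) <= sqnorm ((n * g n k) x)
    & exists2 v, contraction v & strong_cvg \oo (fun k => n * g n k) v].
Proof.
move=> cn; have mp := pos_star_mul n; have m1 := pos_contraction cn.
have rE j k x : rinner ((n * g n k) x) ((n * g n j) x) =
    rinner ((g n j * (n^! * n) * g n k) x) x.
  have [gs _] := newton_factor_pos m1 j.
  by rewrite -{2}gs !mulopE rinner_starV rinner_starV.
have cX k : contraction (n * g n k).
  move=> x; rewrite /sqnorm rE -(addrK (c n k + c n k) (_ * _ * _)).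
  rewrite newton_invariant subopE oneopE rinnerBl gerBl addopE rinnerDl.
  by rewrite addr_ge0 //; have [] := newton_defect_pos m1 k.
have mono j k x : (j <= k)%N -> sqnorm ((n * g n k) x - (n * g n j) x) <=
    sqnorm ((n * g n k) x) - sqnorm ((n * g n j) x).
  move=> jk; have [_ /(_ x)] := newton_monotone mp m1 jk.
  rewrite subopE rinnerBl -!rE sqnormBE /sqnorm.
  move: (rinner _ _) (rinner _ _) (rinner _ _) => p q r; lra.
split => // [k x|].
  have := mono 0%N k x (leq0n k); rewrite [newton_factor _ 0]/(1 : op H) mulr1.
  by have := sqnorm_ge0 ((n * g n k) x - n x); lra.
by apply: (@strong_limit_monotone _ _ _ _ _ leq) => // i; exists i.
Qed.

(** In the limit, [X_k X_k^! X_k = 3 X_k - 2 X_{k+1}] becomes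
    [v v^! v = v].  The norms [X_k^! y] increase from [n^! y] to [v^! y], hence
    [v^! y = 0] forces [n^! y = 0]; taking [y] in the range of [1 - v v^!] gives
    [v v^! n = n]. *)
Lemma polar_contraction n : contraction n -> contraction n^! ->
  exists2 v, [/\ forall k, [/\ (g n k)^! = g n k, contraction (n * g n k)
        & contraction (g n k * n^!)],
      strong_cvg \oo (fun k => n * g n k) v,
      strong_cvg \oo (fun k => g n k * n^!) v^!
    & v * v^! * v = v] & v * v^! * n = n.
Proof.
move=> cn cns; have m1 := pos_contraction cn.
have gs k : (g n k)^! = g n k by have [] := newton_factor_pos m1 k.
have [cX _ [v cv nv]] := newton_strong_cvg cn.
have [cY nY [w cw nw]] := newton_strong_cvg cns.
have YE : (fun k => n^! * g n^! k) = (fun k => g n k * n^!).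
  by apply/funext => k; have [] := newton_intertwine n k.
have YX : (fun k => n^! * g n^! k) = (fun k => (n * g n k)^!).
  by rewrite YE; apply/funext => k; rewrite starM gs.
have wv : w = v^! by apply: strong_cvg_star nv _; rewrite -YX.
have vvv : v * v^! * v = v.
  have l1 : strong_cvg \oo (fun k => (n * g n k) * ((n^! * g n^! k) * (n * g n k)))
      (v * (v^! * v)).
    by apply: strong_cvg_mul => //; apply: strong_cvg_mul => //; rewrite -wv.
  have l2 : strong_cvg \oo (fun k => (n * g n k) * ((n^! * g n^! k) * (n * g n k)))
      (v + v + v - (v + v)).
    have -> : (fun k => (n * g n k) * ((n^! * g n^! k) * (n * g n k))) =
        (fun k => n * g n k + n * g n k + n * g n k -
           (n * g n k.+1 + n * g n k.+1)).
      apply/funext => k; rewrite (congr1 (@^~ k) YX) starM gs.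
      have -> : g n k * n^! * (n * g n k) = 1 - (c n k + c n k).
        by rewrite -(newton_invariant (n^! * n) k) addrK !mulrA.
      by rewrite newton_factorS; op_ring.
    have nv' : strong_cvg \oo (fun k => n * g n k.+1) v.
      by move=> x; rewrite (cvg_shiftS (fun k => (n * g n k) x)); exact: nv.
    by move=> x; apply: cvgB; [apply: cvgD; [apply: cvgD|]|apply: cvgD];
      [exact: nv|exact: nv|exact: nv|exact: nv'|exact: nv'].
  by rewrite -mulrA (strong_cvg_uniq l1 l2); op_ring.
exists v.
  split => // [k|]; last by rewrite -wv -YE.
  by split => //; rewrite -(congr1 (@^~ k) YE).
suff : n^! * (1 - v * v^!) = 0.
  move=> /(congr1 star); rewrite starM starK star0 starB star1 starM starK.
  by rewrite mulrBl mul1r => /subr0_eq.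
apply: opP => z; rewrite zeropE; apply: sqnorm_eq0.
apply/eqP; rewrite eq_le sqnorm_ge0 andbT mulopE.
set y := (1 - v * v^!) z.
have -> : 0 = sqnorm (w y).
  suff -> : w y = 0 by rewrite sqnorm0.
  have vsv : v^! * v * v^! = v^!.
    by have := congr1 star vvv; rewrite !starM starK mulrA.
  by rewrite /y -mulopE wv mulrBr mulr1 mulrA vsv subrr.
by apply: sqnorm_lim_ge (nw y) _ => k; exact: nY.
Qed.

(** The partial isometry [v] of the polar decomposition of [n], described through
    its approximations: as the [h_k] commute with everything that commutes with
    [n^! n], they lie in every von Neumann algebra containing [n^! n]. *)
Lemma polar n : exists v (h : nat -> op H),
  [/\ forall k, [/\ (h k)^! = h k, contraction (n * h k),
        contraction (h k * n^!)
        & forall S, GRing.comm S (n^! * n) -> GRing.comm S (h k)],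
      strong_cvg \oo (fun k => n * h k) v,
      strong_cvg \oo (fun k => h k * n^!) v^!,
      v * v^! * v = v & v * v^! * n = n].
Proof.
have [a a0 na] := op_bound n; have [b b0 nb] := op_bound n^!.
(* r scales both n and its adjoint to contractions *)
pose r := (a + b + 1)^-1; have r0 : 0 < r by rewrite invr_gt0; lra.
have r1 : r * (a + b + 1) = 1 by rewrite mulVf // gt_eqF //; lra.
have shrink (T : op H) (t : R) : 0 <= t -> t <= a + b ->
    (forall x, sqnorm (T x) <= t * sqnorm x) -> contraction (r%:C%C *: T).
  move=> t0 tab Tt x; rewrite scaleopE sqnormZ.
  have := sqnorm_ge0 x; have := Tt x.
  move: (sqnorm _) (sqnorm _) => p q pq q0.
  have rt : r * t <= 1 by nra.
  have r_le1 : r <= 1 by nra.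
  have rrt : r ^+ 2 * t <= 1 by rewrite expr2 -mulrA; nra.
  apply: (@le_trans _ _ (r ^+ 2 * (t * p))); first by rewrite ler_wpM2l ?sqr_ge0.
  by rewrite mulrA -[leRHS]mul1r ler_wpM2r.
set m := r%:C%C *: n.
have ms : m^! = r%:C%C *: n^! by rewrite starZr.
have [||v [gs mv mvs vvv] vvm] := @polar_contraction m.
- by apply: (shrink _ _ a0 _ na); rewrite lerDl.
- by rewrite ms; apply: (shrink _ _ b0 _ nb); rewrite lerDr.
have rN0 : r%:C%C != 0 :> R[i].
  by rewrite -(rmorph0 (real_complex R)) (inj_eq (@complexI R)) gt_eqF.
exists v, (fun k => r%:C%C *: newton_factor (m^! * m) k); split => //.
- move=> k; have [gk c1 c2] := gs k; rewrite starZr gk; split => // [||S Sn].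
  + by rewrite scaleopAr -scaleopAl.
  + by rewrite scaleopAl -scaleopAr -ms.
  apply: commr_scale.
  apply: (newton_comm _ _).1; rewrite ms /m scaleopAl scaleopAr.
  by do 2!apply: commr_scale.
- by move: mv; rewrite /m; under eq_fun do rewrite scaleopAl -scaleopAr.
- by move: mvs; rewrite ms; under eq_fun do rewrite scaleopAr -scaleopAl.
- apply: (scalerI rN0).
  by rewrite -scaleopAr.
Qed.

End PolarDecomposition.

(** * Partial isometries *)

Section PartialIsometries.
Context {R : realType} {H : hilbertType R}.
Implicit Types (p q v w u S T : op H) (x y : H).

Definition partial_isometry v := v * v^! * v = v.

Lemma partial_isometryV v : partial_isometry v -> v^! * v * v^! = v^!.
Proof. by move=> /(congr1 star); rewrite !starM starK mulrA. Qed.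

Lemma partial_isometry_star v : partial_isometry v -> partial_isometry v^!.
Proof. by move=> pv; rewrite /partial_isometry starK partial_isometryV. Qed.

Lemma proj_star_mul v : partial_isometry v -> proj (v^! * v).
Proof. by move=> vv; split; rewrite ?starM ?starK // mulrA -(mulrA v^!) -mulrA vv. Qed.

Lemma partial_isometry_proj v : proj (v^! * v) -> partial_isometry v.
Proof.
move=> [vv _]; apply/subr0_eq/star_mul_eq0.
have -> : (v * v^! * v - v)^! * (v * v^! * v - v) =
  v^! * v * (v^! * v) * (v^! * v) - v^! * v * (v^! * v)
  - v^! * v * (v^! * v) + v^! * v.
  by rewrite starB !starM starK; op_ring.
by rewrite !vv; op_ring.
Qed.

Lemma proj_contraction p : proj p -> contraction p.
Proof.
move=> pp x; rewrite -subr_ge0.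
have -> : sqnorm x - sqnorm (p x) = sqnorm ((1 - p) x).
  by rewrite (proj_sqnorm _ pp) (proj_sqnorm _ (proj1B pp)) subopE oneopE rinnerBl.
exact: sqnorm_ge0.
Qed.

Lemma partial_isometry_contraction v : partial_isometry v -> contraction v.
Proof.
move=> pv x; rewrite {1}/sqnorm rinner_starV rinnerC rinnerC -mulopE.
by rewrite -proj_sqnorm; [apply: proj_contraction|]; exact: proj_star_mul.
Qed.

Lemma projB p q : proj p -> proj q -> q * p = p -> proj (q - p).
Proof.
move=> [pp ps] [qq qs] qp; have pq : p * q = p.
  by have := congr1 star qp; rewrite starM ps qs.
by split; rewrite ?starB ?ps ?qs // mulrBl !mulrBr pp qq qp pq subrr subr0.
Qed.

(** [w] extends [v]: it agrees with [v] on the initial space of [v], and [w^!]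
    agrees with [v^!] on the final space.  Asking for both makes the relation
    invariant under adjoints. *)
Definition restriction v w := w * v^! * v = v /\ v * v^! * w = v.

Section Restriction.
Variables (v w : op H).
Hypotheses (pv : partial_isometry v) (vw : restriction v w).

Lemma restriction_star : restriction v^! w^!.
Proof.
case: vw => vw1 vw2; split; rewrite starK.
  by have := congr1 star vw2; rewrite !starM starK mulrA.
by have := congr1 star vw1; rewrite !starM starK mulrA.
Qed.

Lemma restriction_mull : v^! * w = v^! * v.
Proof. by rewrite -[in LHS](partial_isometryV pv) -!mulrA [v * _]mulrA vw.2. Qed.

Lemma restriction_mulr : w * v^! = v * v^!.
Proof. by rewrite -[in LHS](partial_isometryV pv) !mulrA vw.1. Qed.

(** The vectors [v x] and [w x - v x] are orthogonal. *)
Lemma restriction_sqnorm x : sqnorm (w x - v x) = sqnorm (w x) - sqnorm (v x).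
Proof.
rewrite sqnormBE rinner_starV -mulopE.
have -> : rinner ((v^! * w) x) x = sqnorm (v x).
  by rewrite restriction_mull mulopE -rinner_starV.
by ring.
Qed.
End Restriction.

Lemma restriction_trans v u w : partial_isometry u -> partial_isometry v ->
  restriction u v -> restriction v w -> restriction u w.
Proof.
move=> pu pv uv vw; split.
  have uu : u^! * u = v^! * u.
    by have := congr1 star (restriction_mull pu uv); rewrite !starM !starK.
  rewrite -mulrA uu mulrA (restriction_mulr pv vw) -mulrA -uu mulrA.
  exact: uv.1.
have uu : u * u^! = u * v^!.
  by have := congr1 star (restriction_mulr pu uv); rewrite !starM !starK.
by rewrite uu -mulrA (restriction_mull pv vw) mulrA -uu uv.2.
Qed.

Lemma restriction_refl v : partial_isometry v -> restriction v v.
Proof. by split. Qed.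

Lemma restriction_antisym v w : partial_isometry v -> partial_isometry w ->
  restriction v w -> restriction w v -> v = w.
Proof.
move=> pv pw vw wv.
have vv : v^! * v = w^! * w.
  rewrite -(restriction_mull pv vw) -[RHS](restriction_mull pw wv).
  have := congr1 star (restriction_mull pv vw); rewrite !starM !starK => ->.
  exact: restriction_mull.
by rewrite -[LHS]vw.1 -mulrA vv mulrA pw.
Qed.

(** By [restriction_sqnorm] an increasing family of partial isometries satisfies
    the hypothesis of [strong_limit_monotone], as does the family of its
    adjoints. *)
Lemma restriction_limit {I} {F : set_system I} {FF : ProperFilter F}
    (le : I -> I -> Prop) (A : I -> op H) :
    (forall i, \forall j \near F, le i j) ->
    (forall i, partial_isometry (A i)) ->
    (forall i j, le i j -> restriction (A i) (A j)) ->
  exists L, [/\ strong_cvg F A L, strong_cvg F (fun i => (A i)^!) L^!,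
    partial_isometry L & forall i, restriction (A i) L].
Proof.
move=> leF pA leA.
have [||L _ AL] := @strong_limit_monotone _ _ _ F _ le A leF.
- by move=> i; exact: partial_isometry_contraction.
- by move=> i j x /leA ij; rewrite restriction_sqnorm.
have [||K _ AK] := @strong_limit_monotone _ _ _ F _ le (fun i => (A i)^!) leF.
- by move=> i; apply/partial_isometry_contraction/partial_isometry_star.
- move=> i j x /leA ij; rewrite restriction_sqnorm //.
    exact: partial_isometry_star.
  exact: restriction_star.
have KL : K = L^! by exact: strong_cvg_star AL AK.
have near_eq (C : I -> op H) T S : strong_cvg F C T ->
    (\forall i \near F, C i = S) -> T = S.
  move=> CT CS; apply: strong_cvg_uniq CT _ => x.
  by apply: cvg_near_cst; apply: filterS CS => i ->.
exists L; split; rewrite -?KL //.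
  have AAA : strong_cvg F (fun i => A i * ((A i)^! * A i)) (L * (K * L)).
    apply: (strong_cvg_mul _ AL); last apply: (strong_cvg_mul _ AK AL).
      by move=> i; exact: partial_isometry_contraction.
    by move=> i; apply/partial_isometry_contraction/partial_isometry_star.
  rewrite /partial_isometry -KL -mulrA; apply: strong_cvg_uniq AAA _.
  by under eq_fun do rewrite mulrA pA.
move=> i; split.
  apply: (@near_eq (fun j => A j * (A i)^! * A i)).
    by do 2!apply: strong_cvg_mulr.
  by apply: filterS (leF i) => j /leA[].
apply: (@near_eq (fun j => A i * (A i)^! * A j)); first exact: strong_cvg_mull.
by apply: filterS (leF i) => j /leA[].
Qed.

(** Zorn's lemma for the extension order: a chain converges strongly, along the
    filter of its final segments, to an upper bound.  The class [P] is required
    to be closed under such limits. *)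
Lemma zorn_partial_isometry (P : set (op H)) v0 : P v0 ->
    (forall v, P v -> partial_isometry v) ->
    (forall (I : Type) (F : set_system I) (FF : ProperFilter F)
       (A : I -> op H) L, (forall i, P (A i)) ->
       strong_cvg F A L -> strong_cvg F (fun i => (A i)^!) L^! ->
       (forall i, restriction (A i) L) -> partial_isometry L -> P L) ->
  exists2 v, P v & forall w, P w -> restriction v w -> w = v.
Proof.
move=> Pv0 Ppi Plim.
pose X := {v | P v}; pose le (v w : X) := `[< restriction (sval v) (sval w) >].
have pX (v : X) : partial_isometry (sval v) by exact: Ppi (svalP v).
have [|u v w /asboolP uv /asboolP vw|v w /asboolP vw /asboolP wv|C totC|v vmax] :=
  @Zorn X le.
- by move=> v; apply/asboolP; exact: restriction_refl.
- by apply/asboolP; exact: restriction_trans uv vw.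
- have := restriction_antisym (pX v) (pX w) vw wv.
  by case: v w vw wv => [v Pv] [w Pw] /= _ _ vw; exact: eq_exist.
- have [[c Cc]|C0] := pselect (exists c, C c); last first.
    by exists (exist _ v0 Pv0) => c Cc; case: C0; exists c.
  pose I := {c : X | C c}; pose A (i : I) : op H := sval (sval i).
  pose leI (i j : I) := restriction (A i) (A j).
  pose F : set_system I := filter_from setT (fun i => [set j | leI i j]).
  have FF : ProperFilter F.
    apply: filter_from_proper => [|i _]; last first.
      by exists i; apply: restriction_refl; exact: pX.
    apply: filter_from_filter; first by exists (exist _ c Cc).
    move=> i j _ _; have [ij|ji] := totC _ _ (svalP i) (svalP j).
      exists j => // k jk; split => //.
      exact: restriction_trans (asboolP _ ij) jk.
    exists i => // k ik; split => //.
    exact: restriction_trans (asboolP _ ji) ik.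
  have leF i : \forall j \near F, leI i j by exists i.
  have [L [AL ALs pL AiL]] := restriction_limit leF (fun i => pX _) (fun i j h => h).
  have PL : P L by apply: (Plim I F FF A) => // i; exact: svalP (sval i).
  exists (exist _ L PL) => d Cd; apply/asboolP; exact: (AiL (exist _ d Cd)).
exists (sval v); first exact: svalP.
move=> w Pw vw; have := vmax (exist _ w Pw); rewrite /le /= => /(_ _)/(congr1 sval) /=.
by apply; apply/asboolP.
Qed.
End PartialIsometries.

(** * Von Neumann algebras and factors *)

Section VonNeumann.
Context {R : realType} {H : hilbertType R}.
Implicit Types (b e p q s t v w u S T : op H) (x y : H).

Lemma op_eqE (S T : op H) : (S : H -> H) = T -> S = T.
Proof. by move=> ST; apply: opP => x; rewrite ST. Qed.

Lemma commutantP (B : set (H -> H)) T : B `<=` bounded_operators ->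
  commutant B T <-> forall S, B S -> GRing.comm T S.
Proof.
move=> bB; split=> [[_ TB] S BS|TB].
  by apply/op_eqE/TB.
split=> [|S BS]; first exact: op_bounded.
by have := TB (Op (bB _ BS)) BS => /(congr1 (@op_fun _ _)).
Qed.

Lemma commutant_bounded (B : set (H -> H)) : commutant B `<=` bounded_operators.
Proof. by move=> T []. Qed.

Section Algebra.
Variables (B : set (H -> H)) (vB : von_neumann_algebra B).

Lemma vN_bounded : B `<=` bounded_operators. Proof. by case: vB. Qed.

Lemma vN_commute T S : B T -> commutant B S -> GRing.comm S T.
Proof. by move=> BT /(commutantP _ vN_bounded); apply. Qed.

Lemma vN_mem T : (forall S, commutant B S -> GRing.comm T S) -> B T.
Proof.
move=> TS; have [_ _ <-] := vB.
by apply/commutantP => //; exact: commutant_bounded.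
Qed.

Lemma vN_star T : B T -> B T^!. Proof. by have [_ + _] := vB; apply. Qed.

Lemma commutant_star S : commutant B S -> commutant B S^!.
Proof.
move=> /(commutantP _ vN_bounded) BS; apply/(commutantP _ vN_bounded) => T BT.
have := congr1 star (BS _ (vN_star BT)); rewrite !starM starK.
by move=> h; rewrite /GRing.comm h.
Qed.

Let memP T : B T <-> forall S, commutant B S -> GRing.comm S T.
Proof.
split=> [BT S|h]; first exact: vN_commute.
by apply: vN_mem => S BS; apply/commr_sym/h.
Qed.

Lemma vN1 : B (1 : op H).
Proof. by apply/memP => S _; exact: commr1. Qed.

Lemma vN0 : B (0 : op H).
Proof. by apply/memP => S _; exact: commr0. Qed.

Lemma vND S T : B S -> B T -> B (S + T).
Proof.
by move=> BS BT; apply/memP => K BK; apply: commrD; exact: vN_commute.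
Qed.

Lemma vNB S T : B S -> B T -> B (S - T).
Proof.
by move=> BS BT; apply/memP => K BK; apply: commrB; exact: vN_commute.
Qed.

Lemma vNM S T : B S -> B T -> B (S * T).
Proof.
by move=> BS BT; apply/memP => K BK; apply: commrM; exact: vN_commute.
Qed.

Lemma vNX T n : B T -> B (T ^+ n).
Proof.
by move=> BT; apply/memP => K BK; apply: commrX; exact: vN_commute.
Qed.

Lemma vNZ a T : B T -> B (a *: T).
Proof.
by move=> BT; apply/memP => K BK; apply: commr_scale; exact: vN_commute.
Qed.

(** A strong limit of operators commuting with [S] commutes with [S]. *)
Lemma vN_strong_cvg {I} {F : set_system I} {FF : ProperFilter F}
    (A : I -> op H) L : (forall i, B (A i)) -> strong_cvg F A L -> B L.
Proof.
move=> BA AL; apply/memP => S BS.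
have SA : strong_cvg F (fun i => S * A i) (S * L) by exact: strong_cvg_mull.
apply: strong_cvg_uniq SA _.
have -> : (fun i => S * A i) = (fun i => A i * S).
  by apply/funext => i; exact: vN_commute.
exact: strong_cvg_mulr.
Qed.

Lemma vN_closed_span (X : set H) :
  (forall S x, commutant B S -> X x -> X (S x)) -> B (closed_span X).
Proof.
move=> BX; apply/memP => S BS; apply: closed_span_comm => s Xs; apply: BX => //.
exact: commutant_star.
Qed.

(** The operators [h_k] of [polar] commute with the commutant of [B], because
    [n^! n] does. *)
Lemma vN_polar (n : op H) : B n -> exists v,
  [/\ B v, partial_isometry v, v * v^! * n = n,
      forall q, q * n = n -> q * v = v &
      forall p, p^! = p -> n * p = n -> v * p = v].
Proof.
move=> Bn; have [v [h [hP nv nvs vv vn]]] := polar n.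
have Bh k : B (h k).
  apply/memP => S BS; have [_ _ _] := hP k; apply; apply: commrM; apply: vN_commute => //.
  exact: vN_star.
exists v; split => // [|q qn|p ps np].
- by apply: vN_strong_cvg nv => k; apply: vNM.
- have qv : strong_cvg \oo (fun k => q * (n * h k)) (q * v).
    exact: strong_cvg_mull.
  apply: (strong_cvg_uniq qv).
  by under eq_fun do rewrite mulrA qn.
- have pn : p * n^! = n^! by have := congr1 star np; rewrite starM ps.
  suff : p * v^! = v^! by move=> /(congr1 star); rewrite starM starK ps.
  have pv : strong_cvg \oo (fun k => p * (h k * n^!)) (p * v^!).
    exact: strong_cvg_mull.
  apply: (strong_cvg_uniq pv).
  have ph k : p * h k = h k * p.
    by have [_ _ _] := hP k; apply; rewrite /GRing.comm mulrA pn -mulrA np.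
  by under eq_fun do rewrite mulrA ph -mulrA pn.
Qed.
End Algebra.

Section Factor.
Variables (B : set (H -> H)) (fB : vN_factor B).
Let vB : von_neumann_algebra B := fB.1.

(** The projection onto the closed span of [B p H] lies in [B] and commutes with
    [B]; so it is a scalar.  If [q B p = 0], this scalar operator is killed by
    [q], hence is zero, although it fixes the range of [p]. *)
Lemma factor_link p q : B p -> B q -> p <> 0 -> q <> 0 ->
  exists2 b : op H, B b & q * b * p <> 0.
Proof.
move=> Bp Bq p0 q0; apply: contrapT => no; apply: p0.
have qbp b : B b -> q * b * p = 0.
  by move=> Bb; apply: contrapT => h; apply: no; exists b.
pose X := [set x | exists b y, B (op_fun b) /\ x = b (p y)].
have BZ : B (closed_span X).
  apply: (vN_closed_span vB) => S s BS [b [y [Bb ->]]].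
  exists b, (S y); split => //; rewrite -!mulopE -mulrA.
  by congr (op_fun _ y); apply: commrM; exact: vN_commute BS.
have cZ : commutant B (closed_span X).
  apply/(commutantP _ (vN_bounded vB)) => b Bb; apply/commr_sym/closed_span_comm.
    by move=> _ [c [y [Bc ->]]]; exists (b * c), y; split => //; exact: vNM.
  move=> _ [c [y [Bc ->]]]; exists (b^! * c), y; split => //.
  by apply: vNM => //; exact: vN_star.
have [a _ aZ] : range (fun (c : R[i]) (x : H) => c *: x) (closed_span X).
  by rewrite -fB.2.
have qZ : q * closed_span X = 0.
  apply: closed_span_mul => _ [b [y [Bb ->]]].
  by rewrite -!mulopE qbp.
have a0 : a = 0.
  apply/eqP/negPn/negP => a0; apply: q0; apply: opP => x.
  have := congr1 (fun T : op H => T x) qZ; rewrite mulopE -aZ opZ !zeropE.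
  by move=> /eqP; rewrite scaler_eq0 (negPf a0) => /eqP.
apply: opP => x; rewrite -[LHS](@closed_span_id _ _ X).
  by rewrite -aZ a0 scale0r.
by exists 1, x; split => //; exact: vN1.
Qed.

(** The polar part of a nonzero [q b p]. *)
Lemma factor_partial_isometry p q : B p -> B q -> proj p -> proj q ->
  p <> 0 -> q <> 0 ->
  exists w, [/\ B w, partial_isometry w, w <> 0, q * w = w & w * p = w].
Proof.
move=> Bp Bq [pp ps] [qq qs] p0 q0.
have [b Bb x0] := factor_link Bp Bq p0 q0.
have [|w [Bw pw wx qw wp]] := vN_polar vB (n := q * b * p).
  by apply: vNM => //; apply: vNM.
exists w; split => //.
- by move=> w0; apply: x0; rewrite -wx w0 !mul0r.
- by apply: qw; rewrite !mulrA qq.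
- by apply: wp => //; rewrite -mulrA pp.
Qed.
End Factor.

(** * Comparison of projections *)

Section Comparison.
Variable B : set (H -> H).

Definition equivalent p q := exists u, [/\ B (op_fun u), u^! * u = p & u * u^! = q].
Definition dominated p q := exists u, [/\ B (op_fun u), u^! * u = p & q * u = u].

Hypothesis vB : von_neumann_algebra B.

(** Let [w] embed [p] in [q] and [u] embed [q] in [p].  Then [s = u w] is an
    isometry of [p] into [p1 = u u^!], where [p1] is equivalent to [q].  Put
    [d = p - p1] and let [D] be the sum of the orthogonal projections
    [s^n d s^!^n].  As [s D s^! = D - d], the operator [t = s D + (p - D)]
    satisfies [t^! t = p] and [t t^! = p - d = p1].  The projection [D] is
    obtained as the closed span of the ranges of the [s^n d]. *)
Lemma schroeder_bernstein p q : B p -> B q -> proj p -> proj q ->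
  dominated p q -> dominated q p -> equivalent p q.
Proof.
move=> Bp Bq pp pq [w [Bw ww qw]] [u [Bu uu pu]].
have pw : partial_isometry w by apply: partial_isometry_proj; rewrite ww.
have pu' : partial_isometry u by apply: partial_isometry_proj; rewrite uu.
have [pp1 ps] := pp; have [qq qs] := pq.
have [s sE] : exists s, s = u * w by exists (u * w).
have [p1 p1E] : exists p1 : op H, p1 = u * u^! by exists (u * u^!).
have [d dE] : exists d : op H, d = p - p1 by exists (p - p1).
have Bs : B s by rewrite sE; exact: vNM.
have ss : s^! * s = p by rewrite sE starM -mulrA [u^! * _]mulrA uu qw ww.
have ps' : p * s = s by rewrite sE mulrA pu.
have sp : s * p = s by rewrite sE -mulrA -ww [w * _]mulrA pw.
have p1s : p1 * s = s by rewrite p1E sE -!mulrA [u^! * _]mulrA uu qw.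
have pp1' : p * p1 = p1 by rewrite p1E mulrA pu.
have p1p1 : p1 * p1 = p1 by rewrite p1E mulrA pu'.
have p1p : p1 * p = p1.
  by have := congr1 star pp1'; rewrite starM ps p1E !starM starK.
have pd : p * d = d by rewrite dE mulrBr pp1 pp1'.
have ds : d * s = 0 by rewrite dE mulrBl ps' p1s subrr.
have d_star : d^! = d by rewrite dE starB ps p1E starM starK.
have sd : s^! * d = 0 by have := congr1 star ds; rewrite starM d_star star0.
have Bd : B d by rewrite dE p1E; apply: vNB => //; apply: vNM => //; exact: vN_star.
pose X := [set x | exists n y, x = (s ^+ n * d) y].
pose D := closed_span X.
have XS S : commutant B S -> forall x, X x -> X (S x).
  move=> BS _ [n [y ->]]; exists n, (S y); rewrite -mulopE -[RHS]mulopE.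
  by congr (op_fun _ y); apply: (vN_commute vB) => //; apply: vNM => //; apply: vNX.
have BD : B D by apply: (vN_closed_span vB) => S x /XS; apply.
have psd n : p * (s ^+ n * d) = s ^+ n * d.
  by case: n => [|n]; rewrite ?expr0 ?mul1r // exprS !mulrA ps'.
have Xs x : X x -> X (s x).
  by move=> [n [y ->]]; exists n.+1, y; rewrite -mulopE mulrA -exprS.
have Xss x : X x -> X (s^! x).
  move=> [[|n] [y ->]].
    by exists 0%N, 0; rewrite -mulopE expr0 mul1r sd zeropE op0.
  by exists n, y; rewrite -mulopE exprS -!mulrA [s^! * _]mulrA ss psd.
have sD : s * D = D * s by exact: closed_span_comm.
have [DD Ds] : proj D by exact: closed_span_proj.
have ssD : s^! * D = D * s^!.
  by have := congr1 star sD; rewrite !starM Ds.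
have pD : p * D = D.
  have : (1 - p) * D = 0.
    apply: closed_span_mul => _ [n [y ->]].
    by rewrite -mulopE mulrBl mul1r psd subrr.
  by rewrite mulrBl mul1r => /subr0_eq.
have Dp : D * p = D by have := congr1 star pD; rewrite starM ps Ds.
have Dd : D * d = d.
  apply: opP => y; rewrite mulopE; apply: closed_span_id.
  by exists 0%N, y; rewrite expr0 mul1r.
have p1D : p1 * D = D - d.
  have dD : d * D = d by have := congr1 star Dd; rewrite starM d_star Ds.
  have -> : d = D - p1 * D by rewrite -{1}dD {1}dE mulrBl pD.
  by rewrite opprB addrCA subrr addr0.
have ssD1 : s * s^! * D = D - d.
  have : (p1 - s * s^!) * D = 0.
    apply: closed_span_mul => _ [[|n] [y ->]]; rewrite -mulopE.
      by rewrite expr0 mul1r mulrBl -mulrA sd mulr0 subr0 dE mulrBr p1p p1p1 subrr.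
    by rewrite exprS -!mulrA mulrA mulrBl p1s -mulrA ss sp subrr mul0r.
  by rewrite mulrBl p1D => /subr0_eq ->.
clearbody D; pose t := s * D + (p - D).
have ts : t^! = s^! * D + (p - D) by rewrite /t starD starB starM Ds ps ssD.
have tt : t^! * t = p.
  have -> : t^! * t = s^! * (D * s) * D + s^! * (D * p) - s^! * (D * D)
     + (p * s) * D - (D * s) * D + (p * p) - p * D - D * p + D * D.
    by rewrite ts /t; op_ring.
  rewrite -sD Dp ps' pp1 pD !mulrA ss pD -!mulrA !DD; op_ring.
have tt1 : t * t^! = p1.
  have -> : t * t^! = s * (D * s^!) * D + s * (D * p) - s * (D * D)
     + (p * s^!) * D - (D * s^!) * D + (p * p) - p * D - D * p + D * D.
    by rewrite ts /t; op_ring.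
  have pss : p * s^! = s^! by have := congr1 star sp; rewrite starM ps.
  rewrite -ssD Dp pss pp1 pD -!mulrA !DD mulrA ssD1 -[RHS](subrK p p1) dE; op_ring.
have p1t : p1 * t = t.
  by rewrite -tt1; apply: partial_isometry_proj; rewrite tt.
exists (u^! * t); split.
- apply: vNM => //; first exact: vN_star.
  by apply: vND => //; [exact: vNM|exact: vNB].
- by rewrite starM starK -mulrA [u * _]mulrA -p1E p1t tt.
- rewrite starM starK -mulrA [t * _]mulrA tt1 p1E !mulrA uu.
  by rewrite -mulrA uu qq.
Qed.
End Comparison.
End VonNeumann.

(** * Projections of a type III factor *)

Section TypeIII.
Context {R : realType} {H : hilbertType R}.
Implicit Types (b e p q s t v w u S T : op H) (x y xi : H).

Variables (B : set (H -> H)) (hB : type_III_factor B).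
Let fB : vN_factor B := hB.1.
Let vB : von_neumann_algebra B := fB.1.

Definition separating q xi := forall e, B e -> proj e -> q * e = e ->
  e xi = 0 -> e = 0.

(** The projection [q] onto the closure of [B' xi] lies in [B] and lies below
    [p] because [p] commutes with [B'] and fixes [xi].  If [e] in [B] kills [xi]
    then it kills [B' xi]. *)
Lemma separating_subprojection p xi : B p -> proj p -> p xi = xi -> xi <> 0 ->
  exists q, [/\ B q, proj q, q <> 0, p * q = q & separating q xi].
Proof.
move=> Bp pp pxi xi0.
pose X := [set x | exists S, commutant B S /\ x = S xi].
have BX : B (closed_span X).
  apply: (vN_closed_span vB) => S _ BS [T [BT ->]]; exists (S * T); split => //.
  apply/(commutantP _ (vN_bounded vB)) => b Bb.
  by apply/commr_sym/commrM; apply/commr_sym/(vN_commute vB Bb).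
have cX : closed_span X xi = xi.
  apply: closed_span_id; exists 1; split; rewrite ?oneopE //.
  by apply/(commutantP _ (vN_bounded vB)) => b _; exact/commr_sym/commr1.
have [qq qs] : proj (closed_span X) by exact: closed_span_proj.
exists (closed_span X); split => //.
- by move=> q0; apply: xi0; rewrite -cX q0 zeropE.
- have : (1 - p) * closed_span X = 0.
    apply: closed_span_mul => _ [S [BS ->]]; rewrite subopE oneopE -mulopE.
    by rewrite -(vN_commute vB Bp BS) mulopE pxi subrr.
  by rewrite mulrBl mul1r => /subr0_eq.
move=> e Be [ee es] qe exi; rewrite -[LHS]es -qe starM es qs.
apply: closed_span_mul => _ [S [BS ->]].
by rewrite -mulopE -(vN_commute vB Be BS) mulopE exi op0.
Qed.

Lemma type_III_infinite p : B p -> proj p -> p <> 0 ->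
  exists s, [/\ B s, s^! * s = p, p * s = s & s * s^! <> p].
Proof.
move=> Bp [pp ps] p0; apply: contrapT => no; apply: p0; apply: op_eqE.
apply: (hB.2 p); split.
  by split; [|rewrite -[RHS](congr1 (@op_fun _ _) pp)|exact: (congr1 (@op_fun _ _) ps)].
move=> q [Bq qq qs] pq [v [Bv vv vv']]; apply: contrapT => qp; apply: no.
pose v' := Op (vN_bounded vB Bv); pose q' := Op (vN_bounded vB Bq).
have vp : v'^! * v' = p by exact: op_eqE.
have vq : v' * v'^! = q' by exact: op_eqE.
have pq' : p * q' = q' by exact: op_eqE.
exists v'; split => //; last by rewrite vq => /(congr1 (@op_fun _ _)).
apply/subr0_eq/(can_inj (@starK _ _)); rewrite star0; apply: star_mul_eq0.
have -> : (p * v' - v')^!^! * (p * v' - v')^! =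
   p * (v' * v'^!) * p - (v' * v'^!) * p - p * (v' * v'^!) + v' * v'^!.
  by rewrite starK starB starM ps; op_ring.
by rewrite vq pq' subrr sub0r addNr.
Qed.

(** ** Embedding a separated projection *)

Section Domination.
Variables (p q : op H) (xi : H).
Hypotheses (Bp : B p) (Bq : B q) (pp : proj p) (pq : proj q) (p0 : p <> 0).
Hypothesis q_sep : separating q xi.

Section Exhaustion.
(** Since [s^! s = p] and [s s^!] lies below [p], the projections
    [s^n e s^!^n], for [e = p - s s^!], are orthogonal to each other, below [p],
    and equivalent to [e]. *)
Variable s : op H.
Hypotheses (Bs : B s) (ss : s^! * s = p) (ps : p * s = s).

Let e := p - s * s^!.

Let s_pi : partial_isometry s. Proof. by apply: partial_isometry_proj; rewrite ss. Qed.
Let sp : s * p = s. Proof. by rewrite -ss mulrA s_pi. Qed.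
Let p_star : p^! = p. Proof. exact: pp.2. Qed.
Let ssp : s^! * p = s^!. Proof. by have := congr1 star ps; rewrite starM p_star. Qed.
Let pss : p * s^! = s^!. Proof. by have := congr1 star sp; rewrite starM p_star. Qed.
Let pe : p * e = e. Proof. by rewrite mulrBr pp.1 mulrA ps. Qed.
Let sse : s^! * e = 0. Proof. by rewrite mulrBr mulrA ss ssp pss subrr. Qed.

(** The admissible next pieces once [V] has been built. *)
Let candidate V w := [/\ B w, partial_isometry w, e * w = w &
  w * (q - V^! * V) = w].

(** Some candidate exceeds half of the supremum, unless that vanishes. *)
Let greedy V : exists w, candidate V w /\
  forall w', candidate V w' -> sqnorm (w' xi) <= 2 * sqnorm (w xi).
Proof.
have c0 : candidate V 0.
  by split; rewrite /partial_isometry ?mulr0 ?mul0r //; exact: (vN0 vB).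
pose D := [set sqnorm (w xi) | w in candidate V].
have supD : has_sup D.
  split; first by exists (sqnorm ((0 : op H) xi)), 0.
  by exists (sqnorm xi) => _ [w [_ pw _ _] <-]; exact: partial_isometry_contraction.
have Dle w : candidate V w -> sqnorm (w xi) <= sup D.
  by move=> cw; apply: ub_le_sup; [exact: supD.2|exists w].
have [D0|D0] := leP (sup D) 0.
  exists 0; split => // w /Dle /le_trans; apply.
  by apply: le_trans D0 _; rewrite mulr_ge0 // sqnorm_ge0.
have D2 : 0 < sup D / 2 by rewrite divr_gt0.
have [_ [w cw <-] wD] := sup_adherent D2 supD.
by exists w; split => // w' /Dle; lra.
Qed.

Let f V := projT1 (cid (greedy V)).
Let fP V : candidate V (f V) /\
  forall w', candidate V w' -> sqnorm (w' xi) <= 2 * sqnorm (f V xi).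
Proof. by rewrite /f; case: cid. Qed.

(** The [n]-th piece of [q] is sent into the [n]-th copy of [e]. *)
Fixpoint exhaustion n : op H :=
  if n is m.+1 then exhaustion m + s ^+ m * f (exhaustion m) else 0.
Let V := exhaustion.

Let starX T n : (T ^+ n)^! = T^! ^+ n.
Proof. by elim: n => [|n IH]; rewrite ?expr0 ?star1 // exprS starM IH exprSr. Qed.

Let psn n w : p * w = w -> p * (s ^+ n * w) = s ^+ n * w.
Proof. by case: n => [|n] pw; rewrite ?expr0 ?mul1r // exprS !mulrA ps. Qed.

Let ssn n w : p * w = w -> s^! ^+ n * (s ^+ n * w) = w.
Proof.
move=> pw; elim: n => [|n IH]; first by rewrite !expr0 !mul1r.
by rewrite exprSr [s ^+ n.+1]exprS -!mulrA [s^! * _]mulrA ss psn.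
Qed.

(** The last condition says that the final space of [V n] is orthogonal to the
    copies of [e] that are still free. *)
Let invariant n := [/\ B (V n), partial_isometry (V n), V n * q = V n,
  p * V n = V n & s^! ^+ n * V n = 0].

Let step n : invariant n -> [/\ invariant n.+1, restriction (V n) (V n.+1) &
  sqnorm (V n.+1 xi) = sqnorm (V n xi) + sqnorm (f (V n) xi)].
Proof.
move=> [BV pV Vq pVV ssV]; have VS : V n.+1 = V n + s ^+ n * f (V n) by [].
rewrite /invariant VS; have [cw _] := fP (V n); move: (f (V n)) cw.
move: BV pV Vq pVV ssV; move: (V n) => W BV pV Vq pVV ssV w [Bw pw ew wq].
have pww : p * w = w by rewrite -ew mulrA pe.
set t := s ^+ n * w.
have tt : t^! * t = w^! * w.
  by rewrite /t starM starX -mulrA ssn.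
have Wt : W^! * t = 0.
  have := congr1 star ssV; rewrite starM starX starK star0 /t mulrA => ->.
  by rewrite mul0r.
have tW : t^! * W = 0 by have := congr1 star Wt; rewrite starM starK star0.
have Ww : W * w^! = 0.
  rewrite -wq starM starB starM starK pq.2 mulrA mulrBr Vq mulrA pV subrr.
  by rewrite mul0r.
have Wts : W * t^! = 0 by rewrite /t starM mulrA Ww mul0r.
have tWs : t * W^! = 0 by have := congr1 star Wts; rewrite starM starK star0.
have ttt : t * t^! * t = t by rewrite -mulrA tt /t -[in LHS]mulrA [w * _]mulrA pw.
have wqw : w * q = w.
  by rewrite -wq -mulrA mulrBl pq.1 -mulrA Vq.
have pW' : partial_isometry (W + t).
  rewrite /partial_isometry.
  have -> : (W + t) * (W + t)^! * (W + t) =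
      W * W^! * W + W * (W^! * t) + (W * t^!) * W + (W * t^!) * t +
      (t * W^!) * W + (t * W^!) * t + t * (t^! * W) + t * t^! * t.
    by rewrite starD; op_ring.
  by rewrite pV Wt Wts tWs tW ttt !mulr0 !mul0r !addr0.
split; first split => //.
- by apply: vND => //; apply: vNM => //; exact: vNX.
- by rewrite mulrDl Vq /t -mulrA wqw.
- by rewrite mulrDr pVV /t psn.
- by rewrite mulrDr exprS -!mulrA ssV /t ssn // -ew mulrA sse mul0r mulr0 addr0.
- by split; rewrite ?mulrDl ?mulrDr pV ?tWs -?mulrA ?Wt ?mul0r ?mulr0 addr0.
have cross : rinner (W xi) (t xi) = 0.
  by rewrite rinner_star -mulopE Wt zeropE rinner0r.
rewrite addopE sqnormDE cross mulr0 addr0; congr (_ + _).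
by rewrite /sqnorm !rinner_star -!mulopE tt.
Qed.

Let invariantP n : invariant n.
Proof.
elim: n => [|n /step[]//]; split; rewrite /V /= ?mulr0 ?mul0r //; first exact: vN0.
by rewrite /partial_isometry !mul0r.
Qed.

Let pi_V n : partial_isometry (V n). Proof. by case: (invariantP n). Qed.

Let restriction_V m n : (m <= n)%N -> restriction (V m) (V n).
Proof.
elim: n => [|n IH]; first by rewrite leqn0 => /eqP ->; exact: restriction_refl.
rewrite leq_eqVlt => /orP[/eqP ->|]; first exact: restriction_refl.
rewrite ltnS => /IH mn; apply: restriction_trans mn _ => //.
by case: (step (invariantP n)).
Qed.

(** Let [L] be the limit of the [V n] and suppose that [r = q - L^! L] is not
    zero.  A nonzero partial isometry [w] of [B] from a part of [r] into [e] is
    a candidate at every stage; so by the greedy choice each step adds at least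
    [sqnorm (w xi) / 2] to [sqnorm (V n xi)].  This number is positive as [xi]
    separates [q], but [sqnorm (V n xi)] is bounded by [sqnorm xi]. *)
Lemma exhaustion_dominated : e <> 0 -> dominated B q p.
Proof.
move=> e0.
have Be : B e by apply: vNB => //; apply: vNM => //; exact: vN_star.
have ep : proj e.
  apply: projB => //; last by rewrite mulrA ps.
  have := proj_star_mul (partial_isometry_star s_pi); rewrite starK; exact.
have leF i : \forall j \near \oo, (i <= j)%N by exists i.
have [L [VL VLs pL VnL]] := restriction_limit leF pi_V restriction_V.
have BV n : B (V n) by case: (invariantP n).
have BL : B L by exact: (vN_strong_cvg vB BV VL).
have Lq : L * q = L.
  have VqL : strong_cvg \oo (fun n => V n * q) (L * q) by exact: strong_cvg_mulr.
  apply: (strong_cvg_uniq VqL); have -> // : (fun n => V n * q) = V.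
  by apply/funext => n; case: (invariantP n).
have pL' : p * L = L.
  have pVL : strong_cvg \oo (fun n => p * V n) (p * L) by exact: strong_cvg_mull.
  apply: (strong_cvg_uniq pVL); have -> // : (fun n => p * V n) = V.
  by apply/funext => n; case: (invariantP n).
exists L; split => //; apply/esym/subr0_eq; apply: contrapT => r0.
have LL : L^! * L * q = L^! * L by rewrite -mulrA Lq.
have qLL : q * (L^! * L) = L^! * L.
  by have := congr1 star LL; rewrite !starM starK pq.2.
have Br : B (q - L^! * L) by apply: vNB => //; apply: vNM => //; exact: vN_star.
have rp : proj (q - L^! * L) by apply: projB => //; exact: proj_star_mul.
have [w [Bw pw w0 ew wr]] := factor_partial_isometry fB Br Be rp ep r0 e0.
have wq : w * q = w by rewrite -wr -mulrA mulrBl pq.1 LL.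
have rL : (q - L^! * L) * L^! = 0.
  rewrite mulrBl partial_isometryV //.
  have -> : q * L^! = L^! by have := congr1 star Lq; rewrite starM pq.2.
  exact: subrr.
have cw n : candidate (V n) w.
  split => //; rewrite mulrBr wq.
  suff -> : w * ((V n)^! * V n) = 0 by rewrite subr0.
  have [_ /(congr1 star)] := VnL n; rewrite !starM starK => LV.
  by rewrite -LV -wr -!mulrA [_ * (L^! * _)]mulrA rL mul0r mulr0.
have wxi : w xi <> 0.
  move=> wxi; apply: w0; apply: star_mul_eq0; apply: q_sep.
  - by apply: vNM => //; exact: vN_star.
  - exact: proj_star_mul.
  - have := congr1 star (congr1 (fun T => w^! * T) wq).
    by rewrite !starM starK mulrA pq.2.
  - by rewrite mulopE wxi op0.
have dpos : 0 < sqnorm (w xi) / 2.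
  rewrite divr_gt0 // lt0r sqnorm_ge0 andbT; apply/eqP => /sqnorm_eq0.
  exact: wxi.
apply: (@archimedean_contra _ _ (sqnorm xi) dpos) => n.
apply: (@le_trans _ _ (sqnorm (V n xi))); last exact: partial_isometry_contraction.
elim: n => [|n IH]; first by rewrite mul0r sqnorm_ge0.
have [_ _ ->] := step (invariantP n); rewrite -natr1 mulrDl mul1r lerD //.
by rewrite ler_pdivrMr // mulrC; exact: (fP (V n)).2.
Qed.
End Exhaustion.

Lemma separating_dominated : dominated B q p.
Proof.
have [s [Bs ss ps sp]] := type_III_infinite Bp pp p0.
by apply: (exhaustion_dominated Bs ss ps) => /subr0_eq/esym.
Qed.
End Domination.

Lemma separating_equivalent p q xi eta : B p -> B q -> proj p -> proj q ->
  p <> 0 -> q <> 0 -> separating p xi -> separating q eta -> equivalent B p q.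
Proof.
move=> Bp Bq pp pq p0 q0 sp sq.
by apply: schroeder_bernstein => //;
  [exact: (separating_dominated Bq Bp pq pp q0 sp)|
   exact: (separating_dominated Bp Bq pp pq p0 sq)].
Qed.
End TypeIII.

(** * Extension of normalising partial isometries *)

Section Normalisers.
Context {R : realType} {H : hilbertType R}.
Implicit Types (b e p q s t v w u S T : op H) (x y xi : H).

Variables (B M : set (H -> H)).
Hypotheses (hB : type_III_factor B) (vM : von_neumann_algebra M) (hBM : B `<=` M).
Let vB : von_neumann_algebra B := hB.1.1.

Definition normalises v := forall b, B b -> B (v * b * v^!) /\ B (v^! * b * v).

Lemma normaliserP v : normaliser M B v <-> M v /\ normalises v.
Proof.
split=> -[Mv nv]; split => // b Bb; first by have [] := nv _ Bb.
by have [] := nv (Op (vN_bounded vB Bb)) Bb.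
Qed.

Lemma normalises_mul v w : normalises v -> normalises w -> normalises (v * w).
Proof.
move=> nv nw b Bb; rewrite starM; split.
  by have [+ _] := nv _ (nw _ Bb).1; rewrite !mulrA.
by have [_ +] := nw _ (nv _ Bb).2; rewrite !mulrA.
Qed.

Lemma normalises_mem b : B b -> normalises b.
Proof.
by move=> Bb c Bc; split; do 2?[apply: vNM => //]; exact: vN_star.
Qed.

Lemma unitary_normaliserP u : M u -> u^! * u = 1 -> u * u^! = 1 ->
  normalises u -> unitary_normaliser M B u.
Proof.
move=> Mu uu uu' nu; split => //.
- by apply: (congr1 (@op_fun _ _) uu).
- by apply: (congr1 (@op_fun _ _) uu').
apply/seteqP; split=> [_ [b Bb <-]|b Bb].
  by have [] := nu (Op (vN_bounded vB Bb)) Bb.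
pose b' := Op (vN_bounded vB Bb).
exists (u^! * b' * u); first by have [] := nu b' Bb.
have : u * (u^! * b' * u) * u^! = b'.
  by rewrite !mulrA uu' mul1r -mulrA uu' mulr1.
by move=> /(congr1 (@op_fun _ _)).
Qed.

Section Extension.
Variables (p s : op H) (xi : H).
Hypotheses (Bp : B p) (pp : proj p) (p0 : p <> 0) (sep_p : separating B p xi).
Hypotheses (Ms : M s) (ns : normalises s) (ss : s^! * s = p) (ss' : s * s^! = p).

Let normal_extension u := [/\ M u, partial_isometry u, u^! * u = u * u^!,
  normalises u & restriction s u].

Let s_pi : partial_isometry s. Proof. by apply: partial_isometry_proj; rewrite ss. Qed.
Let ps : p * s = s. Proof. by rewrite -ss'. Qed.
Let sp : s * p = s. Proof. by rewrite -ss mulrA. Qed.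

(** Let [r = 1 - u^! u] and let [e] in [B] embed [p] in [r].  The operator
    [x = e s e^!] is unitary on the range of [e e^!], orthogonally to [u].  The
    sum [u + x] normalises [B] because the mixed terms do so too:
    [e s^! = e p u^! = e u^!] gives [u b x^! = u (b e) u^! e^!], which lies in
    [B]. *)
Lemma extend_normal u : normal_extension u -> u^! * u <> 1 ->
  exists w, [/\ normal_extension w, restriction u w & w <> u].
Proof.
move=> [Mu pu nu nmu su] uu1.
have Bu : B (u^! * u) by have [_] := nmu _ (vN1 vB); rewrite mulr1.
set r := 1 - u^! * u.
have Br : B r by apply: vNB => //; exact: vN1.
have rp : proj r by apply/proj1B/proj_star_mul.
have r0 : r <> 0 by move=> /subr0_eq/esym.
have ur : u * r = 0 by rewrite mulrBr mulr1 mulrA pu subrr.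
have ru : r * u = 0 by rewrite mulrBl mul1r nu pu subrr.
have [e [Be ee re]] := separating_dominated hB Br Bp rp pp r0 sep_p.
have ue : u * e = 0 by rewrite -re mulrA ur mul0r.
have use : u^! * e = 0.
  have ur' : u^! * r = 0 by have := congr1 star ru; rewrite starM rp.2 star0.
  by rewrite -re mulrA ur' mul0r.
have eu : e^! * u = 0 by have := congr1 star use; rewrite starM starK star0.
have eus : e^! * u^! = 0 by have := congr1 star ue; rewrite starM star0.
have e_pi : partial_isometry e by apply: partial_isometry_proj; rewrite ee.
have ep : e * p = e by rewrite -ee mulrA.
have pes : p * e^! = e^! by have := congr1 star ep; rewrite starM pp.2.
have up : u * p = s by rewrite -ss mulrA su.1.
have pu' : p * u = s by rewrite -ss' su.2.
have pus : p * u^! = s^! by have := congr1 star up; rewrite starM pp.2.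
have rp0 : r * p = 0.
  have su' : s^! * u = p by rewrite (restriction_mull s_pi su).
  have us : u^! * s = p by have := congr1 star su'; rewrite starM starK pp.2.
  by rewrite mulrBl mul1r -mulrA up us subrr.
have ep0 : e^! * p = 0.
  by rewrite -[e]re starM rp.2 -mulrA rp0 mulr0.
have pe0 : p * e = 0 by have := congr1 star ep0; rewrite starM starK pp.2 star0.
pose x := e * s * e^!.
have xs : x^! = e * s^! * e^! by rewrite /x !starM starK mulrA.
have xx : x^! * x = e * e^!.
  rewrite xs /x -!mulrA [e^! * (e * _)]mulrA ee [p * _]mulrA ps.
  by rewrite [s^! * _]mulrA ss pes.
have xx' : x * x^! = e * e^!.
  rewrite xs /x -!mulrA [e^! * (e * _)]mulrA ee [s * _]mulrA sp.
  by rewrite [s * _]mulrA ss' pes.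
have x_pi : x * x^! * x = x.
  by rewrite xx' /x -!mulrA [e^! * (e * _)]mulrA ee [p * _]mulrA ps.
have usx : u^! * x = 0 by rewrite /x !mulrA use !mul0r.
have xus : x * u^! = 0 by rewrite /x -!mulrA eus !mulr0.
have xsu : x^! * u = 0 by rewrite xs -!mulrA eu !mulr0.
have uxs : u * x^! = 0 by rewrite xs !mulrA ue !mul0r.
have Bes : B e^! by exact: vN_star.
have Mx : M x by apply: vNM => //; [apply: vNM => //|]; exact: hBM.
have cross b : B b -> [/\ B (u * b * x^!), B (u^! * b * x), B (x * b * u^!)
    & B (x^! * b * u)].
  move=> Bb; have aux (c : op H) : B c -> B (u * c * x^!) /\ B (u^! * c * x).
    move=> Bc; have Bce : B (c * e) by exact: vNM.
    have [n1 n2] := nmu _ Bce; split.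
      have -> : u * c * x^! = u * (c * e) * u^! * e^!.
        by rewrite xs -pus !mulrA -(mulrA (u * c) e p) ep.
      exact: vNM.
    have -> : u^! * c * x = u^! * (c * e) * u * e^!.
      by rewrite /x -pu' !mulrA -(mulrA (u^! * c) e p) ep.
    exact: vNM.
  have [b1 b2] := aux _ Bb; have [c1 c2] := aux _ (vN_star vB Bb); split => //.
    by have := vN_star vB c1; rewrite !starM !starK mulrA.
  by have := vN_star vB c2; rewrite !starM !starK mulrA.
have nx : normalises x.
  by apply: normalises_mul; [apply: normalises_mul|] => //; exact: normalises_mem.
have xp : x * p = 0 by rewrite /x -!mulrA ep0 !mulr0.
have px : p * x = 0 by rewrite /x !mulrA pe0 !mul0r.
clearbody x; exists (u + x); split.
- split.
  + exact: vND.
  + rewrite /partial_isometry.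
    have -> : (u + x) * (u + x)^! * (u + x) = u * u^! * u + (u * u^!) * x
      + (u * x^!) * u + (u * x^!) * x + (x * u^!) * u + (x * u^!) * x
      + x * (x^! * u) + x * x^! * x.
      by rewrite starD; op_ring.
    by rewrite pu -mulrA usx uxs xus xsu x_pi !mul0r !mulr0 !addr0.
  + rewrite starD !mulrDl !mulrDr usx xsu uxs xus xx xx' nu.
    by rewrite !addr0 !add0r.
  + move=> b Bb; have [b1 b2 b3 b4] := cross b Bb.
    have [u1 u2] := nmu b Bb; have [x1 x2] := nx b Bb.
    rewrite starD !mulrDl !mulrDr.
    by split; do ![apply: vND => //].
  + split; first by rewrite -mulrA ss mulrDl up xp addr0.
    by rewrite ss' mulrDr pu' px addr0.
- by split; rewrite ?mulrDl ?mulrDr pu ?xus ?mul0r -?mulrA ?usx ?mulr0 addr0.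
move=> uxu; apply: p0; rewrite -ee.
have x0 : x = 0 by apply: (@addrI _ u); rewrite addr0.
have : e^!^! * e^! = 0 by rewrite starK -xx x0 mulr0.
by move=> /star_mul_eq0 ->; rewrite mul0r.
Qed.

(** By [extend_normal] a maximal extension of [s] is unitary. *)
Lemma unitary_extension : exists2 u, unitary_normaliser M B (op_fun u) & u * p = s.
Proof.
have [||I F FF A L AP AL ALs rL pL|u [Mu pu nu nmu su] umax] :=
  @zorn_partial_isometry _ _ normal_extension s.
- by split => //; rewrite ss ss'.
- by move=> u [].
- have cA i : contraction (A i).
    by have [_ pA _ _ _] := AP i; exact: partial_isometry_contraction.
  have cAs i : contraction (A i)^!.
    have [_ pA _ _ _] := AP i.
    exact/partial_isometry_contraction/partial_isometry_star.
  have [i _] := filter_ex (filterT : F setT).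
  split => //.
  + by apply: (vN_strong_cvg vM _ AL) => j; have [] := AP j.
  + have l1 : strong_cvg F (fun j => (A j)^! * A j) (L^! * L).
      exact: strong_cvg_mul.
    have l2 : strong_cvg F (fun j => (A j)^! * A j) (L * L^!).
      have -> : (fun j => (A j)^! * A j) = (fun j => A j * (A j)^!).
        by apply/funext => j; have [] := AP j.
      exact: strong_cvg_mul.
    exact: strong_cvg_uniq l1 l2.
  + move=> b Bb; split.
      have l : strong_cvg F (fun j => A j * (b * (A j)^!)) (L * (b * L^!)).
        by apply: strong_cvg_mul => //; exact: strong_cvg_mull.
      rewrite -mulrA; apply: (vN_strong_cvg vB _ l) => j; rewrite mulrA.
      by have [_ _ _ /(_ b Bb)[]] := AP j.
    have l : strong_cvg F (fun j => (A j)^! * (b * A j)) (L^! * (b * L)).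
      by apply: strong_cvg_mul => //; exact: strong_cvg_mull.
    rewrite -mulrA; apply: (vN_strong_cvg vB _ l) => j; rewrite mulrA.
    by have [_ _ _ /(_ b Bb)[]] := AP j.
  + have [_ pA _ _ sA] := AP i.
    exact: restriction_trans sA (rL i).
have uu : u^! * u = 1.
  apply: contrapT => uu1.
  have uP : normal_extension u by split.
  have [w [wP uw wu]] := extend_normal uP uu1.
  by apply: wu; apply: umax.
exists u; last by rewrite -ss mulrA su.1.
by apply: unitary_normaliserP => //; rewrite -nu.
Qed.
End Extension.

(** * Generation by unitary normalisers *)

Section Generation.
Variables (N : set (H -> H)) (vN : von_neumann_algebra N).
Hypothesis UN : unitary_normaliser M B `<=` N.

Lemma half_double S T : S + S = T + T -> S = T.
Proof.
move=> ST; have half : (2^-1)%:C%C + (2^-1)%:C%C = 1 :> R[i].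
  by rewrite -rmorphD /=; congr (_%:C%C); field.
by rewrite -[S]scale1r -[T]scale1r -half !scalerDl -!scalerDr ST.
Qed.

Lemma unitary_generated u : B (op_fun u) -> u^! * u = 1 -> u * u^! = 1 -> N u.
Proof.
move=> Bu uu uu'; apply/UN/unitary_normaliserP => //; first exact: hBM.
exact: normalises_mem.
Qed.

(** The normal operator [X = 1 + c], with [c = i a], satisfies [X + X^! = 2] and
    [<X x, x>] has real part [sqnorm x]; so [X] and [X^!] are injective and the
    polar part [v] of [X] is unitary.  Write [X = v k] with [k = v^! X], where
    [k] is self-adjoint and commutes with [v]; then [(v + v^!) k = X + X^! = 2].
    Thus [k] is inverse to half of [v + v^!], so that whatever commutes with [v]
    and [v^!] commutes with [k], hence with [X = v k] and with [a]. *)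
Lemma selfadjoint_generated a : B (op_fun a) -> a^! = a -> N a.
Proof.
move=> Ba a_star; pose c : op H := 'i%C *: a.
have Bc : B c by exact: vNZ.
have cs : c^! = - c.
  rewrite /c starZ a_star -scaleNr; congr (_ *: _).
  by apply/eqP; rewrite eq_complex /= oppr0 !eqxx.
have ac : a = (- 'i%C) *: c.
  by rewrite /c scalerA mulNr -expr2 sqr_i opprK scale1r.
clearbody c; have cx0 x : rinner (c x) x = 0.
  have : rinner (c x) x = - rinner (c x) x.
    by rewrite {1}rinner_star cs oppopE rinnerNr rinnerC.
  by lra.
have [X XE] : exists X : op H, X = 1 + c by exists (1 + c).
have Xs : X^! = 1 - c by rewrite XE starD star1 cs.
have XX : X^! * X = X * X^! by rewrite Xs XE; op_ring.
have X2 : X + X^! = 1 + 1 by rewrite Xs XE; op_ring.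
have BX : B X by rewrite XE; apply: vND => //; exact: vN1.
have Xinj T : X^! * T = 0 -> T = 0.
  move=> XT; apply: opP => x; rewrite zeropE; apply: sqnorm_eq0.
  have := congr1 (fun S : op H => S x) XT; rewrite Xs mulopE subopE oneopE zeropE.
  by move=> /subr0_eq Tx; rewrite /sqnorm {1}Tx cx0.
have [v [h [hP Xv Xvs vvv vvX]]] := polar X.
have v_comm S : GRing.comm S X -> GRing.comm S X^! ->
    GRing.comm S v /\ GRing.comm S v^!.
  move=> SX SXs.
  have Sh k : S * h k = h k * S by have [_ _ _] := hP k; apply; exact: commrM.
  split.
    have l1 : strong_cvg \oo (fun k => S * (X * h k)) (S * v).
      exact: strong_cvg_mull.
    apply: (strong_cvg_uniq l1).
    have -> : (fun k => S * (X * h k)) = (fun k => X * h k * S).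
      by apply/funext => k; rewrite mulrA SX -mulrA Sh mulrA.
    exact: strong_cvg_mulr.
  have l1 : strong_cvg \oo (fun k => S * (h k * X^!)) (S * v^!).
    exact: strong_cvg_mull.
  apply: (strong_cvg_uniq l1).
  have -> : (fun k => S * (h k * X^!)) = (fun k => h k * X^! * S).
    by apply/funext => k; rewrite mulrA Sh -mulrA SXs mulrA.
  exact: strong_cvg_mulr.
have [Xv_comm Xvs_comm] := v_comm X (erefl _) (esym XX).
have [Xsv_comm Xsvs_comm] := v_comm X^! XX (erefl _).
have vX := commr_sym Xv_comm; have vXs := commr_sym Xsv_comm.
have [_ vvs] := v_comm v vX vXs.
have uu' : v * v^! = 1.
  have : 1 - v * v^! = 0.
    apply: Xinj; have := congr1 star vvX; rewrite !starM starK => h0.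
    by rewrite mulrBr mulr1 mulrA -[X in _ - X]mulrA h0 subrr.
  by move=> /subr0_eq.
have uu : v^! * v = 1 by rewrite -vvs.
have Bv : B v.
  apply: (vN_mem vB) => S BS; apply/commr_sym; apply: (v_comm S _ _).1.
    exact: (vN_commute vB BX BS).
  exact: (vN_commute vB (vN_star vB BX) BS).
have Nv : N v by exact: unitary_generated.
pose k := v^! * X.
have k_star : k^! = k.
  have l : strong_cvg \oo (fun j => h j * X^! * X) k by exact: strong_cvg_mulr.
  symmetry; apply: (strong_cvg_star l).
  have -> // : (fun j => (h j * X^! * X)^!) = (fun j => h j * X^! * X).
  apply/funext => j; have [hs _ _] := hP j; rewrite !starM starK hs.
  move=> /(_ (X^! * X) (erefl _)) hj.
  by rewrite mulrA hj mulrA.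
have Xvk : X = v * k by rewrite /k mulrA uu' mul1r.
have Xsvk : X^! = v^! * k.
  have kvs : k * v^! = v^! * k by rewrite /k -mulrA Xvs_comm.
  by rewrite -kvs -[X in X * _]k_star -starM -Xvk.
have ck : (v + v^!) * k = 1 + 1 by rewrite mulrDl -Xvk -Xsvk.
have kc : k * (v + v^!) = 1 + 1.
  by rewrite -ck mulrDr mulrDl /k -!mulrA Xv_comm Xvs_comm [v * (v^! * _)]mulrA
     [v^! * (v * _)]mulrA vvs.
clearbody k; apply: (vN_mem vN) => t Nt; apply/commr_sym.
have tv : GRing.comm t v := vN_commute vN Nv Nt.
have tvs : GRing.comm t v^! := vN_commute vN (vN_star vN Nv) Nt.
have tk : GRing.comm t k.
  apply: half_double.
  have -> : t * k + t * k = (1 + 1) * t * k by rewrite mulrDl mul1r mulrDl.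
  have -> : k * t + k * t = k * t * (1 + 1) by rewrite mulrDr mulr1.
  rewrite -{1}kc -ck -!mulrA; congr (k * _); rewrite !mulrA; congr (_ * k).
  by apply/commr_sym/commrD.
have tX : GRing.comm t X by rewrite Xvk; exact: commrM.
have tc : GRing.comm t c.
  have -> : c = X - 1 by rewrite XE addrC addKr.
  by apply: commrB => //; exact: commr1.
by rewrite ac; exact: commr_scale.
Qed.

Lemma B_generated b : B (op_fun b) -> N b.
Proof.
move=> Bb; have Bbs := vN_star vB Bb.
have -> : b = (2^-1)%:C%C *: ((b + b^!) + (- 'i%C) *: ('i%C *: (b - b^!))).
  apply: half_double; rewrite -!scalerDl -rmorphD /=.
  have -> : 2^-1 + 2^-1 = 1 :> R by field.
  by rewrite scale1r scalerA mulNr -expr2 sqr_i opprK scale1r; op_ring.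
apply: vNZ => //; apply: vND => //; last apply: vNZ => //.
  by apply: selfadjoint_generated; [exact: vND|rewrite starD starK addrC].
apply: selfadjoint_generated; first by apply: vNZ => //; exact: vNB.
rewrite starZ starB starK -[b^! - b]opprB scalerN -scaleNr; congr (_ *: _).
by apply/eqP; rewrite eq_complex /= oppr0 opprK !eqxx.
Qed.

(** The heart of the argument: [p] is chosen below [f] with a separating vector,
    which [v] carries to a separating vector of [q = v p v^!].  So [q] and [p]
    are equivalent in [B] by some [w], and [s = w v p] extends to a unitary
    normaliser [u], for which [v p = w^! u p]. *)
Lemma exists_generated_subprojection v (f : op H) : M v -> normalises v ->
    partial_isometry v -> B f -> proj f -> f <> 0 -> v^! * v * f = f ->
  exists p, [/\ B p, proj p, p <> 0, f * p = p & N (v * p)].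
Proof.
move=> Mv nv pv Bf fp f0 vf.
have [xi fxi] : exists xi, f xi <> 0.
  apply: contrapT => no; apply: f0; apply: opP => x; rewrite zeropE.
  by apply: contrapT => fx; apply: no; exists x.
have ffxi : f (f xi) = f xi by rewrite -mulopE fp.1.
have [p [Bp pp p0 fp' sp]] := separating_subprojection hB Bf fp ffxi fxi.
exists p; split => //; have [pp1 ps] := pp.
set r := v^! * v in vf.
have rp : r * p = p by rewrite -fp' mulrA vf.
have [rr rs] : proj r by exact: proj_star_mul.
have pr : p * r = p by have := congr1 star rp; rewrite starM ps rs.
have [q qE] : exists q, q = v * p * v^! by exists (v * p * v^!).
have Bq : B q by rewrite qE; have [] := nv _ Bp.
have vq : v^! * q * v = p by rewrite qE !mulrA -/r rp -mulrA -/r pr.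
have qs : q^! = q by rewrite qE !starM starK ps mulrA.
have vsq : v^! * q = p * v^! by rewrite qE !mulrA -/r rp.
have qv : q * v = v * p by rewrite qE -mulrA -/r -mulrA pr.
have qq : q * q = q by rewrite {2}qE !mulrA qv -(mulrA v) pp1.
have q0 : q <> 0 by move=> q0; apply: p0; rewrite -vq q0 mulr0 mul0r.
have vvq : v * v^! * q = q by rewrite qE !mulrA pv.
have sq : separating B q (v (f xi)).
  move=> e Be [ee es] qe ev.
  have ve : v * (v^! * e) = e by rewrite -qe !mulrA vvq.
  have vve T : v * (v^! * (e * T)) = e * T by rewrite [v^! * _]mulrA mulrA ve.
  have e'0 : v^! * e * v = 0.
    apply: sp; first by have [] := nv _ Be.
    - split; last by rewrite !starM starK es mulrA.
      by rewrite -!mulrA vve [e * (e * v)]mulrA ee.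
    - by rewrite !mulrA -vsq -(mulrA v^! q e) qe.
    - by rewrite !mulopE ev op0.
  have := congr1 (fun T => v * T) e'0; rewrite -!mulrA vve mulr0.
  by move=> /(congr1 star); rewrite starM es star0 -{2}ve => ->; rewrite mulr0.
have [w [Bw ww ww']] := separating_equivalent hB Bq Bp (conj qq qs) pp q0 p0 sq sp.
have w_pi : partial_isometry w by apply: partial_isometry_proj; rewrite ww; split.
pose s := w * v * p.
have ns : normalises s.
  by apply: normalises_mul; [apply: normalises_mul|] => //; exact: normalises_mem.
have Ms : M s.
  by apply: vNM => //; [apply: vNM => //|]; exact: hBM.
have sE : s^! = p * v^! * w^! by rewrite /s !starM ps mulrA.
have ss : s^! * s = p.
  by rewrite sE /s -!mulrA [w^! * (w * _)]mulrA ww !mulrA -(mulrA p) vsq mulrA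
    pp1 -(mulrA p v^!) -/r pr pp1.
have ss' : s * s^! = p.
  rewrite sE /s -!mulrA [p * (p * _)]mulrA pp1 [p * (v^! * _)]mulrA.
  by rewrite [v * (_ * _)]mulrA [v * (p * _)]mulrA -qE -ww !mulrA w_pi ww'.
have [u Uu us] := unitary_extension Bp pp p0 sp Ms ns ss ss'.
have -> : v * p = w^! * (u * p).
  by rewrite us /s !mulrA ww qv -mulrA pp1.
apply: (vNM vN); first by apply: B_generated; exact: vN_star.
by apply: (vNM vN); [exact: UN|exact: B_generated].
Qed.


(** Let [e] be the supremum of the projections [p <= v^! v] of [B] with [v p] in
    [N].  If [e] were not [v^! v], the difference would contain another such
    projection.  For [t] commuting with [N], the operator [t v - v t] vanishes
    on the ranges of all these [p], hence on that of [v^! v], which means that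
    it is zero. *)
Lemma groupoid_generated v : M v -> normalises v -> partial_isometry v -> N v.
Proof.
move=> Mv nv pv; have rp := proj_star_mul pv.
have Br : B (v^! * v) by have [_] := nv _ (vN1 vB); rewrite mulr1.
set r := v^! * v in rp Br.
have vr : v * r = v by rewrite mulrA pv.
pose P (p : op H) := [/\ B p, proj p, r * p = p & N (v * p)].
pose X := [set x | exists (p : op H) y, P p /\ x = p y].
have [e eE] : exists e, e = closed_span X by exists (closed_span X).
have Be : B e.
  rewrite eE; apply: (vN_closed_span vB) => S _ BS [p [y [Pp ->]]].
  have [Bp _ _ _] := Pp; exists p, (S y); split => //.
  by rewrite -!mulopE (vN_commute vB Bp BS).
have ep : proj e by rewrite eE; exact: closed_span_proj.
have re : r * e = e.
  have : (1 - r) * e = 0.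
    rewrite eE; apply: closed_span_mul => _ [p [y [[_ _ rp' _] ->]]].
    by rewrite -mulopE mulrBl mul1r rp' subrr.
  by rewrite mulrBl mul1r => /subr0_eq.
have er : e = r.
  apply/esym/subr0_eq; apply: contrapT => f0.
  have Bf : B (r - e) by exact: vNB.
  have rf : r * (r - e) = r - e by rewrite mulrBr rp.1 re.
  have [p [Bp pp p0 fp Nvp]] :=
    exists_generated_subprojection Mv nv pv Bf (projB ep rp re) f0 rf.
  apply: p0; have rp' : r * p = p by rewrite -fp mulrA rf.
  have ep' : e * p = p.
    apply: opP => y; rewrite mulopE eE; apply: closed_span_id.
    by exists p, y.
  by rewrite -fp mulrBl rp' ep' subrr.
apply: (vN_mem vN) => t Nt; apply/commr_sym.
have tr : GRing.comm t r := vN_commute vN (B_generated Br) Nt.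
have : (t * v - v * t) * e = 0.
  rewrite eE; apply: closed_span_mul => _ [p [y [[Bp _ _ Nvp] ->]]].
  rewrite -mulopE mulrBl -!mulrA (vN_commute vN (B_generated Bp) Nt).
  by rewrite (vN_commute vN Nvp Nt) !mulrA subrr.
by rewrite er mulrBl -!mulrA vr tr mulrA vr => /subr0_eq.
Qed.

(** For [b] in [B], the operators [(n h_k) b (h_k n^!) = n (h_k b h_k) n^!] lie
    in [B] and converge strongly to [v b v^!]; similarly for [v^! b v] and for
    [v^! n].  So [v] normalises [B] and [n = v (v^! n)]. *)
Lemma normaliser_generated n : M (op_fun n) -> normalises n -> N n.
Proof.
move=> Mn nn; have [v [h [hP nv nvs pv vvn]]] := polar n.
have Bnn : B (n^! * n) by have [_] := nn _ (vN1 vB); rewrite mulr1.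
have Bh k : B (h k).
  apply: (vN_mem vB) => S BS; apply/commr_sym; have [_ _ _] := hP k; apply.
  exact: (vN_commute vB Bnn BS).
have Mv : M v.
  by apply: (vN_strong_cvg vM _ nv) => k; apply: (vNM vM) => //; exact: hBM.
have cnh k : contraction (n * h k) by case: (hP k).
have chn k : contraction (h k * n^!) by case: (hP k).
have nvn : normalises v.
  move=> b Bb; rewrite -!mulrA; split.
    have l : strong_cvg \oo (fun k => n * h k * (b * (h k * n^!))) (v * (b * v^!)).
      by apply: strong_cvg_mul => //; exact: strong_cvg_mull.
    apply: (vN_strong_cvg vB _ l) => k.
    have Bhbh : B (h k * b * h k) by do 2!apply: vNM => //.
    by have [+ _] := nn _ Bhbh; rewrite !mulrA.
  have l : strong_cvg \oo (fun k => h k * n^! * (b * (n * h k))) (v^! * (b * v)).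
    by apply: strong_cvg_mul => //; exact: strong_cvg_mull.
  apply: (vN_strong_cvg vB _ l) => k.
  have -> : h k * n^! * (b * (n * h k)) = h k * (n^! * b * n) * h k.
    by rewrite !mulrA.
  by apply: vNM => //; apply: vNM => //; have [] := nn _ Bb.
have Bvn : B (v^! * n).
  have l : strong_cvg \oo (fun k => h k * n^! * n) (v^! * n).
    exact: strong_cvg_mulr.
  by apply: (vN_strong_cvg vB _ l) => k; rewrite -mulrA; exact: vNM.
rewrite -vvn -mulrA; apply: (vNM vN); first exact: groupoid_generated.
exact: B_generated.
Qed.

End Generation.

Lemma groupoid_normaliser_sub : groupoid_normaliser M B `<=` normaliser M B.
Proof. by move=> v []. Qed.

Lemma unitary_normaliser_sub :
  unitary_normaliser M B `<=` groupoid_normaliser M B.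
Proof.
move=> u [Mu uu uu' uB]; pose u' := Op (vN_bounded vM Mu).
have eu : u'^! * u' = 1 by exact: op_eqE.
have eu' : u' * u'^! = 1 by exact: op_eqE.
split; last by have := congr1 (fun T : op H => op_fun (T * u')) eu'; rewrite mul1r.
apply: (normaliserP u').2; split => // b Bb; split.
  by rewrite -uB; exists b.
have : B b by []; rewrite -{1}uB => -[c Bc cb].
pose c' := Op (vN_bounded vB Bc).
have <- : u' * c' * u'^! = b by exact: op_eqE.
by rewrite !mulrA eu mul1r -mulrA eu mulr1.
Qed.

Lemma Wstar_eq (X Y : set (H -> H)) : X `<=` Y ->
  (forall N, von_neumann_algebra N -> X `<=` N -> Y `<=` N) ->
  Wstar M Y = Wstar M X.
Proof.
move=> XY gen; apply/seteqP; split=> T WT N [[vN NM] XN].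
  by apply: WT; split => //; exact: gen.
by apply: WT; split => // S /XY; exact: XN.
Qed.

Lemma normaliser_sub_of_unitary (N : set (H -> H)) : von_neumann_algebra N ->
  unitary_normaliser M B `<=` N -> normaliser M B `<=` N.
Proof.
move=> vN UN n nn; have [Mn _] := nn; pose n' := Op (vN_bounded vM Mn).
have [_ nn'] := (normaliserP n').1 nn.
exact: (@normaliser_generated N vN UN n').
Qed.

End Normalisers.

(** * The three generated algebras coincide *)

Local Close Scope ring_scope.

Theorem proposition3p15 (R : realType) (H : hilbertType R)
    (B M : set (H -> H))
    (hB : type_III_factor B) (hM : type_III_factor M) (hBM : B `<=` M) :
  (Wstar M (normaliser M B) = Wstar M (groupoid_normaliser M B) /\
   Wstar M (groupoid_normaliser M B) = Wstar M (unitary_normaliser M B)) /\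
  (regular M B <-> unitary_regular M B).
Proof.
have vM := hM.1.1.
have UG := @unitary_normaliser_sub _ _ B M hB vM.
have GN := @groupoid_normaliser_sub _ _ B M.
have NU : Wstar M (normaliser M B) = Wstar M (unitary_normaliser M B).
  apply: Wstar_eq => [u /UG /GN //|N vN UN].
  exact: (normaliser_sub_of_unitary hB vM hBM vN UN).
have GU : Wstar M (groupoid_normaliser M B) = Wstar M (unitary_normaliser M B).
  apply: Wstar_eq => // N vN UN v /GN.
  exact: (normaliser_sub_of_unitary hB vM hBM vN UN).
split; first by rewrite NU GU.
by rewrite /regular /unitary_regular NU.
Qed.
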